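(* Fix an integer $k>0$ and let $1$, $\delta$, $\varsigma$ denote the trivial, $\det$, and $\mathrm{sgn}(\det)$ characters of $GL_k(\mathbb{R})$. Then for every integer $i>0$ there exists a non-zero intertwining operator of $GL_{2k}(\mathbb{R})$-representations $$1\times\delta^i\varsigma\;\to\;\delta^i\times\varsigma .$$
   Context: For characters $\chi_1,\chi_2$ of $GL_k(\mathbb{R})$, let $P=P_{k,k}\subset GL_{2k}(\mathbb{R})$ be the subgroup of block upper triangular matrices $x=\begin{pmatrix}x_{11}&x_{12}\\0&x_{22}\end{pmatrix}$ with $k\times k$ blocks, with modular function $\Delta_P(x)=|\det x_{11}|^{k}|\det x_{22}|^{-k}$. Then $\chi_1\times\chi_2$ denotes the normalized induced representation: $GL_{2k}(\mathbb{R})$ acts by right translation $(R_gf)(y)=f(yg)$ on the space of $f\in C^\infty(GL_{2k}(\mathbb{R}))$ with $f(xy)=\chi_1(x_{11})\chi_2(x_{22})\Delta_P^{1/2}(x)f(y)$ for all $x\in P$, $y\in GL_{2k}(\mathbb{R})$. Intertwining operators are continuous equivariant linear maps. *)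

(* Defs.v *)
From HB Require Import structures.
From mathcomp Require Import all_boot all_order all_fingroup all_algebra complex.
From mathcomp Require Import all_classical all_reals all_analysis.
Import numFieldNormedType.Exports.

Set Implicit Arguments.
Unset Strict Implicit.
Unset Printing Implicit Defensive.

Import Order.TTheory GRing.Theory Num.Theory.

Local Open Scope classical_set_scope.
Local Open Scope ring_scope.
Local Open Scope complex_scope.

Section GL.
Variables (R : realType) (n : nat).

Record GL := MkGL { GLmx :> 'M[R]_n ; GLmx_unit : GLmx \in unitmx }.

HB.instance Definition _ := [isSub for GLmx].
HB.instance Definition _ := [Choice of GL by <:].

Definition GL_one : GL := MkGL (unitmx1 R n).

Lemma GL_mul_subproof (x y : GL) : (x : 'M[R]_n) *m y \in unitmx.
Proof. by rewrite unitmx_mul !GLmx_unit. Qed.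
Definition GL_mul (x y : GL) : GL := MkGL (GL_mul_subproof x y).

Lemma GL_inv_subproof (x : GL) : invmx (x : 'M[R]_n) \in unitmx.
Proof. by rewrite unitmx_inv GLmx_unit. Qed.
Definition GL_inv (x : GL) : GL := MkGL (GL_inv_subproof x).

Lemma GL_mulA : associative GL_mul.
Proof. by move=> x y z; apply/val_inj; rewrite /= mulmxA. Qed.
Lemma GL_mul1 : left_id GL_one GL_mul.
Proof. by move=> x; apply/val_inj; rewrite /= mul1mx. Qed.
Lemma GL_mulr1 : right_id GL_one GL_mul.
Proof. by move=> x; apply/val_inj; rewrite /= mulmx1. Qed.
Lemma GL_mulV : left_inverse GL_one GL_inv GL_mul.
Proof. by move=> x; apply/val_inj; rewrite /= mulVmx ?GLmx_unit. Qed.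
Lemma GL_mulrV : right_inverse GL_one GL_inv GL_mul.
Proof. by move=> x; apply/val_inj; rewrite /= mulmxV ?GLmx_unit. Qed.

HB.instance Definition _ :=
  isGroup.Build GL GL_mulA GL_mul1 GL_mulr1 GL_mulV GL_mulrV.

HB.instance Definition _ :=
  Topological.copy GL (initial_topology GLmx).

Lemma GLmx_continuous : continuous (GLmx : GL -> 'M[R]_n).
Proof. exact: initial_continuous. Qed.

Lemma GL_mulE (x y : GL) : GLmx (x * y)%g = (x : 'M[R]_n) *m y.
Proof. by []. Qed.

Lemma GL_oneE : GLmx 1%g = 1%:M.
Proof. by []. Qed.

Lemma sum_continuous (I : Type) (r : seq I) (F : I -> 'M[R]_n -> R) :
  (forall i, continuous (F i)) -> continuous (fun x => \sum_(i <- r) F i x).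
Proof.
move=> cF x; elim: r => [|a r IH].
  rewrite (_ : (fun y => _) = (fun=> 0)); last first.
    by apply/funext => y; rewrite big_nil.
  exact: cst_continuous.
rewrite (_ : (fun y => _) = F a \+ (fun y => \sum_(i <- r) F i y)).
  by apply: continuousD => //; apply: cF.
by apply/funext => y; rewrite big_cons.
Qed.

Lemma det_continuous : continuous (fun x : 'M[R]_n => \det x).
Proof.
have cM (I : Type) (r : seq I) (F : I -> 'M[R]_n -> R) :
    (forall i, continuous (F i)) -> continuous (fun x => \prod_(i <- r) F i x).
  move=> cF x; elim: r => [|a r IH].
    rewrite (_ : (fun y => _) = (fun=> 1)); last first.
      by apply/funext => y; rewrite big_nil.
    exact: cst_continuous.
  rewrite (_ : (fun y => _) = F a \* (fun y => \prod_(i <- r) F i y)).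
    by apply: continuousM => //; apply: cF.
  by apply/funext => y; rewrite big_cons.
have cT (s : 'S_n) :
    continuous (fun y : 'M[R]_n => (-1) ^+ s * \prod_i y i (s i)).
  have cP := cM _ (index_enum _) (fun (i : 'I_n) (y : 'M[R]_n) => y i (s i))
    (fun i => @coord_continuous R n n i (s i)).
  move=> x; pose c : 'M[R]_n -> R := cst ((-1) ^+ s).
  have cc : {for x, continuous c} by apply: cst_continuous.
  exact: continuousM cc (cP x).
exact: sum_continuous cT.
Qed.

Lemma mulmxr_continuous (g : 'M[R]_n) :
  continuous (mulmxr g : 'M[R]_n -> 'M[R]_n).
Proof.
have cij i j : continuous (fun x : 'M[R]_n => (x *m g) i j).
  have cT k : continuous (fun x : 'M[R]_n => x i k * g k j).
    move=> x; apply: (@continuousM _ _ _ (cst (g k j))).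
      exact: coord_continuous.
    exact: cst_continuous.
  rewrite (_ : (fun x => _) = fun x : 'M[R]_n => \sum_k x i k * g k j).
    exact: sum_continuous cT.
  by apply/funext => x; rewrite mxE.
move=> x A [B nB BA]; rewrite nbhs_simpl.
have : \forall y \near x, forall i j, B i j ((y *m g) i j).
  apply: (@filter_forall _ 'I_n
    (fun i y => forall j, B i j ((y *m g) i j)) (nbhs x) _) => i.
  apply: (@filter_forall _ 'I_n
    (fun j y => B i j ((y *m g) i j)) (nbhs x) _) => j.
  exact: (cij i j x _ (nB i j)).
move=> H; apply: filterS H => y yB.
by apply: BA.
Qed.

Lemma open_unitmx : open [set x : 'M[R]_n | x \in unitmx].
Proof.
rewrite (_ : mkset _ = (fun x : 'M[R]_n => \det x) @^-1` [set y | y != 0]).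
  by apply: open_comp => [x _|]; [exact: det_continuous | exact: open_neq].
by apply/seteqP; split=> x /=; rewrite unitmxE unitfE.
Qed.
End GL.

Section smooth.
Variables (R : realType) (V : normedModType R).

(* f is of class C^m on the open set U. For finite-dimensional V, asking that
   every 'D_v f be of class C^(m-1) is asking this of x |-> 'd f x. *)
Fixpoint class_C (m : nat) (U : set V) (f : V -> R) : Prop :=
  match m with
  | 0 => forall x, U x -> {for x, continuous f}
  | m'.+1 => (forall x, U x -> differentiable f x) /\
             forall v, class_C m' U (fun x => 'D_v f x)
  end.

Lemma near_eq_differentiable (f g : V -> R) x :
  (\near x, f x = g x) -> differentiable f x -> differentiable g x.
Proof.
move=> fg /diff_locallyP[cdf fE].
have fgx : f x = g x by apply: nbhs_singleton fg.
have gE : g \o shift x = cst (g x) + 'd f x +o_ (0 : V) id.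
  apply/eqaddoP => e e0; move/eqaddoP: fE => /(_ e e0).
  have fg0 : \forall y \near (0 : V), f (y + x) = g (y + x).
    move: fg; rewrite (near_shift 0 x); apply: filterS => y /=.
    by rewrite subr0.
  apply: filterS2 fg0 => y.
  by rewrite !fctE /= fgx => ->.
by apply/diff_locallyP; rewrite (diff_unique cdf gE).
Qed.

Lemma eq_class_C m (U : set V) f g : open U ->
  (forall x, U x -> f x = g x) -> class_C m U f -> class_C m U g.
Proof.
move=> oU; elim: m f g => [|m IH] f g fg /=.
  move=> cf x Ux; rewrite /prop_for /continuous_at -(fg _ Ux).
  apply: cvg_trans (cf x Ux); apply: near_eq_cvg.
  by apply: filterS (open_nbhs_nbhs (conj oU Ux)) => y /fg.
have nfg x : U x -> \near x, f x = g x.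
  by move=> Ux; apply: filterS (open_nbhs_nbhs (conj oU Ux)) => y /fg.
move=> [df Df]; split=> [x Ux|v].
  exact: near_eq_differentiable (nfg x Ux) (df x Ux).
apply: IH (Df v) => x Ux; exact/near_eq_derive/nfg.
Qed.

Lemma class_C_lin m (U : set V) (a b : R) f g : open U ->
  class_C m U f -> class_C m U g -> class_C m U (fun x => a * f x + b * g x).
Proof.
move=> oU; elim: m f g => [|m IH] f g /=.
  move=> cf cg x Ux; apply: cvgD; apply: cvgM;
    [exact: cvg_cst|exact: cf|exact: cvg_cst|exact: cg].
move=> [df Df] [dg Dg]; split=> [x Ux|v].
  apply: differentiableD; apply: differentiableZ; [exact: df|exact: dg].
apply: eq_class_C (IH _ _ (Df v) (Dg v)) => // x Ux.
have daf : derivable (a *: f) x v by apply/derivableZ/diff_derivable/df.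
have dbg : derivable (b *: g) x v by apply/derivableZ/diff_derivable/dg.
have dfv : derivable f x v by apply/diff_derivable/df.
have dgv : derivable g x v by apply/diff_derivable/dg.
transitivity ('D_v (a *: f + b *: g) x) => //.
by rewrite (deriveD daf dbg) (deriveZ _ dfv) (deriveZ _ dgv).
Qed.

Lemma class_C_comp m (U : set V) (L : {linear V -> V}) f :
  open U -> continuous L -> class_C m U f -> class_C m (L @^-1` U) (f \o L).
Proof.
move=> oU cL; elim: m f => [|m IH] f /=.
  by move=> cf x Ux; apply: continuous_comp; [exact: cL|exact: cf].
move=> [df Df]; split=> [x Ux|v].
  by apply: differentiable_comp; [exact: linear_differentiable|exact: df].
apply: eq_class_C (IH _ (Df (L v))).
  by apply: open_comp => // x _; exact: cL.
move=> x Ux /=; have dL : differentiable L x by exact: linear_differentiable.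
have dfL : differentiable f (L x) by exact: df.
rewrite (deriveE _ dfL) (deriveE _ (differentiable_comp dL dfL)).
by rewrite (diff_comp dL dfL) /= (diff_lin x cL).
Qed.
End smooth.

Section jets.
Variables (R : realType) (n : nat).
Implicit Types (f : GL R n -> R[i]) (h : 'M[R]_n -> R[i]) (v : 'M[R]_n).

(* The extension by 0 is a device to differentiate on the matrix space: only its
   derivatives at points of the open set GL_n(R) are ever used. *)
Definition ext f : 'M[R]_n -> R[i] := fun x => oapp f 0 (insub x).

Definition smooth f : Prop :=
  forall m, class_C m [set x | x \in unitmx] (fun x => complex.Re (ext f x)) /\
            class_C m [set x | x \in unitmx] (fun x => complex.Im (ext f x)).

Definition dirderiv v h : 'M[R]_n -> R[i] :=
  fun x => ('D_v (fun y => complex.Re (h y)) x) +i* ('D_v (fun y => complex.Im (h y)) x).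

(* For vs = [:: v1; ...; vr], the restriction to GL_n(R) of the iterated
   directional derivative D_v1 (... (D_vr f)). *)
Definition jet f (vs : seq 'M[R]_n) : GL R n -> R[i]^o :=
  fun x => foldr dirderiv (ext f) vs x.

Lemma extE f (x : GL R n) : ext f x = f x.
Proof. by rewrite /ext valK. Qed.

Lemma ext_lin a f g : ext (a *: f + g) = (fun x => a * ext f x + ext g x).
Proof.
apply/funext => x; rewrite /ext; case: insubP => [u _ _|_] //=.
by rewrite mulr0 addr0.
Qed.

Lemma smooth_lin a f g : smooth f -> smooth g -> smooth (a *: f + g).
Proof.
move=> sf sg m; rewrite ext_lin; have [fR fI] := sf m; have [gR gI] := sg m.
have oU := @open_unitmx R n; split.
- apply: eq_class_C oU _ (class_C_lin 1 1 oU
    (class_C_lin (complex.Re a) (- complex.Im a) oU fR fI) gR) => x _.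
  by rewrite !mul1r mulNr; case: a (ext f x) (ext g x) => ? ? [? ?] [? ?].
- apply: eq_class_C oU _ (class_C_lin 1 1 oU
    (class_C_lin (complex.Re a) (complex.Im a) oU fI fR) gI) => x _.
  by rewrite !mul1r; case: a (ext f x) (ext g x) => ? ? [? ?] [? ?].
Qed.

Lemma smooth0 : smooth 0.
Proof.
move=> m.
have -> : ext 0 = fun=> 0 by apply/funext => x; rewrite /ext; case: insub.
suff H : forall c, class_C m [set x : 'M[R]_n | x \in unitmx] (fun=> c).
  by split.
elim: m => [c x _|m IH c]; first exact: cst_continuous.
split=> [x _|v]; first exact: differentiable_cst.
suff -> : (fun x => 'D_v (fun=> c) x) = (fun=> 0) by exact: IH.
by apply/funext => x; exact: derive_cst.
Qed.

Definition rtrans_fun (g : GL R n) f : GL R n -> R[i] := fun y => f (y * g)%g.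

Lemma smooth_rtrans g f : smooth f -> smooth (rtrans_fun g f).
Proof.
pose L : {linear 'M[R]_n -> 'M[R]_n} := mulmxr g.
have extL x : x \in unitmx -> ext f (L x) = ext (rtrans_fun g f) x.
  move=> ux; pose y := MkGL ux.
  by rewrite -[x]/(GLmx y) -[L y]/(GLmx (y * g)%g) !extE.
have LU : L @^-1` [set x | x \in unitmx] = [set x | x \in unitmx].
  by apply/seteqP; split=> x /=; rewrite unitmx_mul GLmx_unit andbT.
have cL : continuous L by exact: mulmxr_continuous.
have oU := @open_unitmx R n.
move=> sf m; have [fR fI] := sf m; split.
- apply: (eq_class_C oU); last first.
    by have := class_C_comp oU cL fR; rewrite LU; apply.
  by move=> x Ux /=; rewrite extL.
- apply: (eq_class_C oU); last first.
    by have := class_C_comp oU cL fI; rewrite LU; apply.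
  by move=> x Ux /=; rewrite extL.
Qed.
End jets.

Section character.
Variables (R : realType) (n : nat).

Record character := Character {
  chfun :> GL R n -> R[i] ;
  ch1 : chfun 1%g = 1 ;
  chM : forall x y, chfun (x * y)%g = chfun x * chfun y ;
  ch_continuous : continuous (chfun : GL R n -> R[i]^o) }.

Lemma triv_charM (x y : GL R n) : (1 : R[i]) = 1 * 1.
Proof. by rewrite mulr1. Qed.
Lemma triv_char_continuous : continuous ((fun=> 1) : GL R n -> R[i]^o).
Proof. exact: cst_continuous. Qed.
Definition triv_char : character :=
  @Character (fun=> 1) erefl triv_charM triv_char_continuous.

Lemma realC_continuous : continuous (fun x : R => x%:C : R[i]^o).
Proof.
move=> x; apply/cvgrPdist_lt => e e0.
have eE : e = (complex.Re e)%:C.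
  by case: e e0 => a b; rewrite ltcE /= => /andP[/eqP-> _].
have re0 : 0 < complex.Re e by move: e0; rewrite eE ltcR.
have : \forall y \near x, `|x - y| < complex.Re e.
  have /cvgrPdist_lt := (cvg_id : y @[y --> x] --> x).
  exact.
by apply: filterS => y; rewrite -rmorphB normc_def /= expr0n addr0 sqrtr_sqr eE ltcR.
Qed.

Lemma GLdet_continuous : continuous (fun x : GL R n => \det x).
Proof.
move=> x; apply: continuous_comp; first exact: GLmx_continuous.
exact: det_continuous.
Qed.

Lemma det_char1 : (\det (1%g : GL R n))%:C = 1 :> R[i].
Proof. by rewrite det1. Qed.
Lemma det_charM (x y : GL R n) :
  (\det (x * y)%g)%:C = (\det x)%:C * (\det y)%:C :> R[i].
Proof. by rewrite det_mulmx rmorphM. Qed.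
Lemma det_char_continuous : continuous (fun x : GL R n => (\det x)%:C : R[i]^o).
Proof.
move=> x; apply: (@continuous_comp _ _ _ (fun y : GL R n => \det y)).
  exact: GLdet_continuous.
exact: realC_continuous.
Qed.
Definition det_char : character :=
  @Character (fun x => (\det x)%:C) det_char1 det_charM det_char_continuous.

Lemma sgndet_char1 : (Num.sg (\det (1%g : GL R n)))%:C = 1 :> R[i].
Proof. by rewrite det1 sgr1. Qed.
Lemma sgndet_charM (x y : GL R n) :
  (Num.sg (\det (x * y)%g))%:C =
  (Num.sg (\det x))%:C * (Num.sg (\det y))%:C :> R[i].
Proof. by rewrite det_mulmx sgrM rmorphM. Qed.
Lemma sgndet_char_continuous :
  continuous (fun x : GL R n => (Num.sg (\det x))%:C : R[i]^o).
Proof.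
move=> x; apply: (@cvg_near_cst _ _ _ _ (nbhs x) (nbhs_filter x)).
have : \det x != 0 by have := GLmx_unit x; rewrite unitmxE unitfE.
rewrite neq_lt => /orP[d0|d0].
- have H : \forall y \near x, \det (y : GL R n) < 0.
    exact: (cvgr_lt (\det x) (@GLdet_continuous x)).
  by apply: filterS H => y dy; rewrite !ltr0_sg.
- have H : \forall y \near x, 0 < \det (y : GL R n).
    exact: (cvgr_gt (\det x) (@GLdet_continuous x)).
  by apply: filterS H => y dy; rewrite !gtr0_sg.
Qed.
Definition sgndet_char : character :=
  @Character (fun x => (Num.sg (\det x))%:C)
    sgndet_char1 sgndet_charM sgndet_char_continuous.

Section mul_char.
Variables chi psi : character.
Lemma mul_char1 : chi 1%g * psi 1%g = 1.
Proof. by rewrite !ch1 mulr1. Qed.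
Lemma mul_charM x y : chi (x * y)%g * psi (x * y)%g =
  (chi x * psi x) * (chi y * psi y).
Proof. by rewrite !chM mulrACA. Qed.
Lemma mul_char_continuous : continuous (fun x => chi x * psi x : R[i]^o).
Proof.
move=> x.
have c1 : {for x, continuous (chi : GL R n -> R[i]^o)} by exact: ch_continuous.
have c2 : {for x, continuous (psi : GL R n -> R[i]^o)} by exact: ch_continuous.
exact: (@continuousM R[i] _ _ _ _ c1 c2).
Qed.
Definition mul_char : character :=
  @Character (fun x => chi x * psi x) mul_char1 mul_charM mul_char_continuous.
End mul_char.

Fixpoint exp_char (chi : character) (m : nat) : character :=
  if m is m'.+1 then mul_char chi (exp_char chi m') else triv_char.

Lemma exp_charE chi m x : exp_char chi m x = chi x ^+ m.
Proof. by elim: m => [|m IH]; rewrite ?expr0//= IH exprS. Qed.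

End character.

Section induced.
Variables (R : realType) (k : nat).
Implicit Types (chi : character R k).

Lemma parab_subproof (x11 x22 : GL R k) (x12 : 'M[R]_k) :
  block_mx x11 x12 0 x22 \in unitmx.
Proof. by rewrite unitmxE det_ublock unitrM -!unitmxE !GLmx_unit. Qed.

(* the general element of P = P_{k,k}; see parabP *)
Definition parab x11 x12 x22 : GL R (k + k) :=
  MkGL (parab_subproof x11 x22 x12).

Lemma parabP (x : GL R (k + k)) :
  reflect (exists x11 x12 x22, x = parab x11 x12 x22) (dlsubmx x == 0).
Proof.
apply: (iffP eqP) => [x0|[x11 [x12 [x22 ->]]]]; last exact: block_mxKdl.
have xE : GLmx x = block_mx (ulsubmx x) (ursubmx x) 0 (drsubmx x).
  by rewrite -x0 submxK.
have := GLmx_unit x; rewrite xE unitmxE det_ublock unitrM -!unitmxE.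
move=> /andP[u1 u2]; exists (MkGL u1), (ursubmx x), (MkGL u2).
exact/val_inj.
Qed.

(* the modular function of P at parab x11 x12 x22, which is independent of x12 *)
Definition modP (x11 x22 : GL R k) : R :=
  `|\det x11| ^+ k * `|\det x22| ^- k.

Definition ind_pred chi1 chi2 : pred (GL R (k + k) -> R[i]) := fun f =>
  `[< smooth f /\
      forall x11 x12 x22 (y : GL R (k + k)),
        f (parab x11 x12 x22 * y)%g =
        chi1 x11 * chi2 x22 * (Num.sqrt (modP x11 x22))%:C * f y >].

(* the space of the normalized induced representation chi1 x chi2 *)
Record ind chi1 chi2 := MkInd {
  indfun :> GL R (k + k) -> R[i] ;
  indfunP : ind_pred chi1 chi2 indfun }.

Section space.
Variables chi1 chi2 : character R k.
Local Notation I := (ind chi1 chi2).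

HB.instance Definition _ := [isSub for @indfun chi1 chi2].
HB.instance Definition _ := [Choice of I by <:].

Lemma ind_submod_closed : submod_closed (ind_pred chi1 chi2).
Proof.
split=> [|a f g /asboolP[sf fP] /asboolP[sg gP]]; apply/asboolP; split.
- exact: smooth0.
- by move=> *; rewrite mulr0.
- exact: smooth_lin.
- by move=> x11 x12 x22 y; rewrite !fctE fP gP mulrDr [a *: _]mulrCA.
Qed.

HB.instance Definition _ :=
  GRing.isSubmodClosed.Build R[i] (GL R (k + k) -> R[i])
    (ind_pred chi1 chi2) ind_submod_closed.
HB.instance Definition _ := [SubChoice_isSubLmodule of I by <:].

(* The topology induced by C^oo(GL_2k(R)): uniform convergence on compact
   subsets of GL_2k(R) of all iterated derivatives. *)
HB.instance Definition _ := Topological.copy I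
  (initial_topology (fun f : I => @jet R (k + k) f
     : {ptws (seq 'M[R]_(k + k)) ->
             {family compact, GL R (k + k) -> R[i]^o}})).

Lemma ind_rtrans_subproof (g : GL R (k + k)) (f : I) :
  ind_pred chi1 chi2 (rtrans_fun g f).
Proof.
have /asboolP[sf fP] := indfunP f; apply/asboolP; split.
  exact: smooth_rtrans.
by move=> x11 x12 x22 y; rewrite /rtrans_fun -mulgA fP.
Qed.

Definition rtrans (g : GL R (k + k)) (f : I) : I :=
  MkInd (ind_rtrans_subproof g f).

Lemma rtransE g f y : rtrans g f y = f (y * g)%g. Proof. by []. Qed.

Lemma rtrans_is_linear g : linear (rtrans g).
Proof. by move=> a f h; apply/val_inj. Qed.

Lemma rtrans1 f : rtrans 1%g f = f.
Proof. by apply/val_inj/funext => y; rewrite /= /rtrans_fun mulg1. Qed.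

Lemma rtransM g h f : rtrans (g * h)%g f = rtrans g (rtrans h f).
Proof. by apply/val_inj/funext => y; rewrite /= /rtrans_fun mulgA. Qed.
End space.

Definition intertwining chi1 chi2 psi1 psi2
    (T : {linear ind chi1 chi2 -> ind psi1 psi2}) : Prop :=
  continuous T /\ forall g f, T (rtrans g f) = rtrans g (T f).

End induced.

(* Main.v *)
Require Import Defs.
From HB Require Import structures.
From mathcomp Require Import all_boot all_order all_fingroup all_algebra complex.
From mathcomp Require Import all_classical all_reals all_analysis.
From mathcomp Require Import -(notations) ssrcomplements mpoly.
From mathcomp Require Import ring.
Import numFieldNormedType.Exports.

(** Left translation by the unipotent matrices (1 0; Z 1) gives commuting vector
    fields M_ab on GL_2k that are invariant under right translation. The operator
    is T = det(M)^i; it is a differential operator, hence continuous, and it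
    commutes with right translation. Conjugating by diag(g, d) multiplies det(M)
    by det(d) / det(g), which is the equivariance of T f under the Levi factor.
    For f in the source and a field X of an upper unipotent elementary matrix,
    X kills f, and commuting X past p(M) gives X p(M) f = (b p)(M) f, where
      b = (i - k) d_ab - sum_(c, e) x_ce d_cb d_ae
    is a Bessel operator on polynomials in the entries of a generic matrix x. It
    kills det(x)^i, because sum_e x_ce d_ae replaces row a of x by row c; so T f
    is invariant under the unipotent radical. Finally T is not zero: on the
    function |det y|^(k/2) det(c)^i det(d) det(cc^T + dd^T)^(-(k+1)/2), where
    (c d) is the lower half of y, the value of T f at 1 is the sum of m! a_m^2
    over the coefficients a_m of the polynomial det(x)^i. *)

Set Implicit Arguments.
Unset Strict Implicit.
Unset Printing Implicit Defensive.

Import Order.TTheory GRing.Theory Num.Theory.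

Local Open Scope classical_set_scope.
Local Open Scope ring_scope.

(** * Smooth functions and symmetry of second derivatives *)

(** The exponent [i] is dictated by the Levi factor: the inducing characters of target and source
    differ on diag(g, d) by (det g / det d)^i, which is inverse to the factor that conjugation puts
    on det(M)^i. The normalization of the induction enters through the constant i - k. Along the
    Levi field that arises, det(d)^i contributes i and the half modulus contributes -k; the latter
    cancels the k commutators of x_ce with d_cb in the Bessel operator, one for each c. The two
    factors of P need different arguments. The unipotent radical is connected, so invariance is
    checked on its Lie algebra and integrated along lines. The Levi factor is disconnected and
    carries a sign character, so it is handled by conjugation in the group. Smoothness shapes the
    test function: sgn(det d) is required but jumps where det d vanishes. The factor det(d) supplies
    the sign, and its absolute value is absorbed by raising the exponent of the Gram determinant
    from k/2 to (k+1)/2. The coefficients of det(x)^i are real, so the calculus is done on real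
    functions and applied to real and imaginary parts. *)

Section smooth_functions.
Variables (R : realType) (V : normedModType R) (U : set V).
Hypothesis oU : open U.
Implicit Types (f g h : V -> R) (v w x : V).

Definition smooth_on h := forall m, class_C m U h.

Lemma class_CS m h : class_C m.+1 U h -> class_C m U h.
Proof.
elim: m h => [|m IH] h /= [dh Dh].
  by move=> x Ux; exact/differentiable_continuous/dh.
by split=> // v; apply/IH/Dh.
Qed.

Lemma class_C_subset m (W : set V) h : U `<=` W -> class_C m W h -> class_C m U h.
Proof.
move=> UW; elim: m h => [|m IH] h /=; first by move=> ch x /UW; exact: ch.
by move=> [dh Dh]; split=> [x /UW|v]; [exact: dh|exact/IH/Dh].
Qed.

Lemma class_C_mul m f g :
  class_C m U f -> class_C m U g -> class_C m U (fun x => f x * g x).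
Proof.
elim: m f g => [|m IH] f g.
  by move=> cf cg x Ux; apply: cvgM; [exact: cf|exact: cg].
(* The Leibniz rule multiplies each derivative by an undifferentiated factor, which is needed in
   class [m] only. *)
move=> cf cg; have cf' := class_CS cf; have cg' := class_CS cg.
move: cf cg => [df Df] [dg Dg]; split=> [x Ux|v].
  by apply: differentiableM; [exact: df|exact: dg].
apply: eq_class_C oU _ (class_C_lin 1 1 oU (IH _ _ cf' (Dg v))
  (IH _ _ cg' (Df v))) => x Ux.
rewrite (_ : (fun y => f y * g y) = f * g)// deriveM ?mul1r//.
  exact/diff_derivable/df.
exact/diff_derivable/dg.
Qed.

Lemma class_C_inv m f : (forall x, U x -> f x != 0) ->
  class_C m U f -> class_C m U (fun x => (f x)^-1).
Proof.
move=> f0; elim: m => [|m IH].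
  by move=> cf x Ux; apply: cvgV; [exact: f0|exact: cf].
move=> cf; have cf' := class_CS cf.
move: cf => [df Df]; split=> [x Ux|v].
  by apply: differentiableV; [exact: df|exact: f0].
(* The derivative -f' / f^2 contains 1/f again, one class lower, so the induction closes. *)
have cV := IH cf'.
apply: eq_class_C oU _ (class_C_lin (-1) 0 oU
  (class_C_mul (class_C_mul cV cV) (Df v)) cV) => x Ux.
rewrite deriveV ?f0//; last exact/diff_derivable/df.
by rewrite mul0r addr0 -exprVn expr2 mulN1r scaleNr.
Qed.

Lemma class_C_sqrt m f : (forall x, U x -> 0 < f x) ->
  class_C m U f -> class_C m U (fun x => Num.sqrt (f x)).
Proof.
move=> f0; elim: m => [|m IH].
  move=> cf x Ux; apply: (continuous_comp (cf x Ux)).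
  exact: sqrt_continuous.
move=> cf; have cf' := class_CS cf.
have ds x : U x -> differentiable (Num.sqrt : R -> R) (f x).
  by move=> Ux; apply/derivable1_diffP; have [] := is_derive1_sqrt (f0 x Ux).
move: cf => [df Df]; split=> [x Ux|v].
  exact: (differentiable_comp (df x Ux) (ds x Ux)).
have cS := IH cf'; have s0 x : U x -> 2 * Num.sqrt (f x) != 0.
  by move=> Ux; rewrite mulf_neq0// gt_eqF// sqrtr_gt0 f0.
have c2S := class_C_lin 2 0 oU cS cS.
have cI : class_C m U (fun x => (2 * Num.sqrt (f x))^-1).
  apply: class_C_inv => //; apply: eq_class_C oU _ c2S => x _.
  by rewrite mul0r addr0.
apply: eq_class_C oU _ (class_C_mul cI (Df v)) => x Ux.
have dfx := df x Ux; have dsx := ds x Ux.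
rewrite (_ : (fun y => Num.sqrt (f y)) = Num.sqrt \o f)//.
rewrite (deriveE _ (differentiable_comp dfx dsx)) (diff_comp dfx dsx) /=.
rewrite -(deriveE _ dfx) deriv1E ?derive1E ?derive_sqrt ?f0//=; last first.
  exact/derivable1_diffP.
by rewrite [RHS]mulrC.
Qed.

Lemma smooth_onP h : smooth_on h <->
  (forall x, U x -> differentiable h x) /\ forall v, smooth_on ('D_v h).
Proof.
split=> [sh|[dh Dh] [|m]].
- by split=> [|v m]; [have [dh _] := sh 1%N|have [_ Dh] := sh m.+1; exact: Dh].
- by move=> x Ux; exact/differentiable_continuous/dh.
- by split=> // v; exact: Dh.
Qed.

Lemma smooth_on_diff h x : smooth_on h -> U x -> differentiable h x.
Proof. by move=> /smooth_onP[dh _]; exact: dh. Qed.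

Lemma smooth_on_continuous h x : smooth_on h -> U x -> {for x, continuous h}.
Proof. by move=> sh; exact: (sh 0). Qed.

Lemma smooth_on_derive h v : smooth_on h -> smooth_on ('D_v h).
Proof. by move=> /smooth_onP[]. Qed.

Lemma smooth_on_derives h vs :
  smooth_on h -> smooth_on (foldr (fun v g => 'D_v g) h vs).
Proof. by move=> sh; elim: vs => //= v vs; exact: smooth_on_derive. Qed.

Lemma eq_smooth_on f g : (forall x, U x -> f x = g x) ->
  smooth_on f -> smooth_on g.
Proof. by move=> fg sf m; exact: eq_class_C oU fg (sf m). Qed.

Lemma smooth_onM f g :
  smooth_on f -> smooth_on g -> smooth_on (fun x => f x * g x).
Proof. by move=> sf sg m; exact: class_C_mul. Qed.

Lemma smooth_onD f g :
  smooth_on f -> smooth_on g -> smooth_on (fun x => f x + g x).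
Proof.
move=> sf sg m; apply: eq_class_C oU _ (class_C_lin 1 1 oU (sf m) (sg m)).
by move=> x _; rewrite !mul1r.
Qed.

Lemma smooth_onV f : (forall x, U x -> f x != 0) ->
  smooth_on f -> smooth_on (fun x => (f x)^-1).
Proof. by move=> f0 sf m; exact: class_C_inv. Qed.

Lemma smooth_on_sqrt f : (forall x, U x -> 0 < f x) ->
  smooth_on f -> smooth_on (fun x => Num.sqrt (f x)).
Proof. by move=> f0 sf m; exact: class_C_sqrt. Qed.

Lemma smooth_on_cst (c : R) : smooth_on (fun=> c).
Proof.
move=> m; elim: m c => [c x _|m IH c]; first exact: cst_continuous.
split=> [x _|v]; first exact: differentiable_cst.
suff -> : (fun x : V => 'D_v (fun=> c) x) = (fun=> 0 : R) by exact: IH.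
by apply/funext => x; exact: derive_cst.
Qed.

Lemma smooth_onX f n : smooth_on f -> smooth_on (fun x => f x ^+ n).
Proof.
move=> sf; elim: n => [|n IH]; first exact: smooth_on_cst.
by apply: eq_smooth_on (smooth_onM sf IH) => x _; rewrite exprS.
Qed.

Lemma smooth_on_sum (I : Type) (r : seq I) (P : pred I) (F : I -> V -> R) :
  (forall i, smooth_on (F i)) -> smooth_on (fun x => \sum_(i <- r | P i) F i x).
Proof.
move=> sF; elim: r => [|a r IH].
  by apply: eq_smooth_on (smooth_on_cst 0) => x _; rewrite big_nil.
have [Pa|nPa] := boolP (P a); last first.
  by apply: eq_smooth_on IH => x _; rewrite big_cons (negbTE nPa).
by apply: eq_smooth_on (smooth_onD (sF a) IH) => x _; rewrite big_cons Pa.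
Qed.

Lemma smooth_on_prod (I : Type) (r : seq I) (F : I -> V -> R) :
  (forall i, smooth_on (F i)) -> smooth_on (fun x => \prod_(i <- r) F i x).
Proof.
move=> sF; elim: r => [|a r IH].
  by apply: eq_smooth_on (smooth_on_cst 1) => x _; rewrite big_nil.
by apply: eq_smooth_on (smooth_onM (sF a) IH) => x _; rewrite big_cons.
Qed.

Lemma derive_linear (l : {linear V -> R}) x v :
  continuous l -> 'D_v l x = l v.
Proof.
by move=> cl; rewrite deriveE ?diff_lin//; exact: linear_differentiable.
Qed.

Lemma smooth_on_linear (l : {linear V -> R}) : continuous l -> smooth_on l.
Proof.
move=> cl; apply/smooth_onP; split=> [x _|v].
  exact: linear_differentiable.
by apply: eq_smooth_on (smooth_on_cst (l v)) => x _; rewrite derive_linear.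
Qed.

Lemma line_derive h x v (a : R) : differentiable h (x + a *: v) ->
  is_derive a 1 (fun t : R => h (x + t *: v)) ('D_v h (x + a *: v)).
Proof.
move=> dh; have dl : is_diff a (fun t : R => x + t *: v) (fun t => t *: v).
  have -> : (fun t : R => t *: v) = 0 + (fun t : R => t *: v).
    by rewrite add0r.
  exact: is_diffD.
have /differentiableP dh' := dh.
have dc := is_diff_comp dl dh'.
have dd : differentiable (h \o (fun t : R => x + t *: v)) a by [].
rewrite (_ : (fun t => _) = h \o (fun t : R => x + t *: v))//.
apply: DeriveDef; first exact/derivable1_diffP.
by rewrite (deriveE _ dd) diff_val /= scale1r -deriveE.
Qed.

Lemma line_MVT h x v (s : R) : 0 < s ->
  (forall a, 0 <= a <= s -> differentiable h (x + a *: v)) ->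
  exists2 a, 0 <= a <= s & h (x + s *: v) - h x = s * 'D_v h (x + a *: v).
Proof.
move=> s0 dh.
have dl a : 0 <= a <= s ->
    is_derive a 1 (fun t : R => h (x + t *: v)) ('D_v h (x + a *: v)).
  by move=> as_; apply/line_derive/dh.
have [a||c] := @MVT R (fun t => h (x + t *: v))
    (fun t => 'D_v h (x + t *: v)) 0 s s0.
- by rewrite in_itv /= => /andP[a0 as_]; apply: dl; rewrite !ltW.
- apply: derivable_within_continuous => a; rewrite in_itv /= => as_.
  by have [] := dl a as_.
rewrite in_itv /= subr0 scale0r addr0 => /andP[c0 cs] ->.
by exists c; rewrite ?(ltW c0) ?(ltW cs)// mulrC.
Qed.

(** The mean value theorem is used twice: along [v] for the difference [g z = h (z + s w) - h z],
    then along [w] for ['D_v h]. *)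
Lemma second_difference h x v w (s : R) : smooth_on h -> 0 < s ->
  (forall a b, 0 <= a <= s -> 0 <= b <= s -> U (x + a *: v + b *: w)) ->
  exists a b, [/\ 0 <= a <= s, 0 <= b <= s &
    h (x + s *: v + s *: w) - h (x + s *: v) - h (x + s *: w) + h x =
    s * s * 'D_w ('D_v h) (x + a *: v + b *: w)].
Proof.
move=> sh s0 UU; have s00 : 0 <= (0 : R) <= s by rewrite lexx ltW.
have ss : 0 <= s <= s by rewrite lexx ltW.
pose g z := h (z + s *: w) - h z.
have dshift z : differentiable (fun y : V => y + s *: w) z.
  by apply: differentiableD.
have dg1 a : 0 <= a <= s ->
    differentiable (h \o (fun y : V => y + s *: w)) (x + a *: v).
  move=> as_; apply: differentiable_comp (dshift _) _.
  by apply: smooth_on_diff => //; exact: UU.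
have dg2 a : 0 <= a <= s -> differentiable h (x + a *: v).
  move=> as_; apply: smooth_on_diff => //.
  by rewrite -[_ + _]addr0 -(scale0r w); exact: UU.
have [a as_ ga] : exists2 a, 0 <= a <= s &
    g (x + s *: v) - g x = s * 'D_v g (x + a *: v).
  by apply: line_MVT => // a as_; apply: differentiableB (dg1 a as_) (dg2 a as_).
have Dg : 'D_v g (x + a *: v) =
    'D_v h (x + a *: v + s *: w) - 'D_v h (x + a *: v).
  rewrite /g (_ : (fun z => _) = (h \o (fun y : V => y + s *: w)) - h)//.
  rewrite deriveB; try exact/diff_derivable/dg1; try exact/diff_derivable/dg2.
  congr (_ - _).
  have dh : differentiable h (x + a *: v + s *: w).
    by apply: smooth_on_diff => //; exact: UU.
  rewrite deriveE; last exact: dg1.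
  rewrite diff_comp//= -deriveE//; congr ('D__ h _).
  rewrite (_ : (fun y => _) = id + cst (s *: w))// diffD//.
  by rewrite /= diff_cst diff_val [X in _ + X]/= addr0.
have [b bs hb] : exists2 b, 0 <= b <= s &
    'D_v h (x + a *: v + s *: w) - 'D_v h (x + a *: v) =
    s * 'D_w ('D_v h) (x + a *: v + b *: w).
  apply: (@line_MVT ('D_v h) (x + a *: v) w s s0) => b bs.
  exact: smooth_on_diff (smooth_on_derive v sh) (UU a b as_ bs).
exists a, b; split=> //; rewrite -mulrA -hb -Dg -ga /g.
by rewrite opprB addrA addrAC.
Qed.

(** The second difference is symmetric in [v] and [w]. Evaluated in both orders, it equates the two
    mixed derivatives at points near [x], and continuity carries this to [x]. *)
Lemma derive_comm h x v w : smooth_on h -> U x ->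
  'D_w ('D_v h) x = 'D_v ('D_w h) x.
Proof.
move=> sh Ux; apply/eqP; rewrite -subr_eq0 -normr_eq0.
apply/eqP/le_anti; rewrite normr_ge0 andbT; apply/ler_addgt0Pr => e e0.
rewrite add0r; have e2 : 0 < e / 2 by rewrite divr_gt0.
have c1 : {for x, continuous ('D_w ('D_v h))}.
  by apply: smooth_on_continuous => //; do 2 apply: smooth_on_derive.
have c2 : {for x, continuous ('D_v ('D_w h))}.
  by apply: smooth_on_continuous => //; do 2 apply: smooth_on_derive.
have /cvgrPdist_lt/(_ _ e2) n1 := c1; have /cvgrPdist_lt/(_ _ e2) n2 := c2.
have nU : nbhs x U by apply: open_nbhs_nbhs; split.
have [r /= r0 Hr] := (nbhs_ballP _ _).1 (filterI nU (filterI n1 n2)).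
(* The step [s] keeps the whole parallelogram in the ball where both mixed derivatives vary by less
   than [e / 2]; the [+ 1] covers [v = w = 0]. *)
pose N := `|v| + `|w| + 1.
have N0 : 0 < N by rewrite ltr_wpDl.
pose s := r / 2 / N; have s0 : 0 < s by rewrite !divr_gt0.
have close a b : 0 <= a <= s -> 0 <= b <= s ->
    ball x r (x + a *: v + b *: w).
  rewrite -ball_normE /= => /andP[a0 as_] /andP[b0 bs].
  rewrite opprD addrA opprD addrA subrr add0r -opprD normrN.
  apply: le_lt_trans (ler_normD _ _) _; rewrite !normrZ !ger0_norm//.
  have : a * `|v| + b * `|w| <= s * N.
    rewrite !mulrDr mulr1 -[leLHS]addr0 !lerD ?(ltW s0)//.
    - exact: ler_wpM2r.
    - exact: ler_wpM2r.
  move=> /le_lt_trans; apply; rewrite /s divfK ?gt_eqF//.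
  by rewrite ltr_pdivrMr// ltr_pMr// ltr1n.
have [a [b [as_ bs E1]]] : exists a b, [/\ 0 <= a <= s, 0 <= b <= s &
    h (x + s *: v + s *: w) - h (x + s *: v) - h (x + s *: w) + h x =
    s * s * 'D_w ('D_v h) (x + a *: v + b *: w)].
  by apply: second_difference => // a b as_ bs; have [] := Hr _ (close _ _ as_ bs).
have [b' [a' [bs' as' E2]]] : exists a b, [/\ 0 <= a <= s, 0 <= b <= s &
    h (x + s *: w + s *: v) - h (x + s *: w) - h (x + s *: v) + h x =
    s * s * 'D_v ('D_w h) (x + a *: w + b *: v)].
  apply: second_difference => // a' b' as' bs'; rewrite (addrAC x).
  by have [] := Hr _ (close _ _ bs' as').
have E : 'D_w ('D_v h) (x + a *: v + b *: w) =
         'D_v ('D_w h) (x + b' *: w + a' *: v).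
  have ss0 : s * s != 0 by rewrite mulf_neq0 ?gt_eqF.
  apply: (mulfI ss0); refine (etrans (esym E1) (etrans _ E2)).
  by rewrite (addrAC x (s *: w)); congr (_ + _); rewrite [LHS]addrAC.
have [_ [d1 _]] := Hr _ (close _ _ as_ bs).
have [_ [_ d2]] := Hr _ (close _ _ as' bs').
rewrite (addrAC x) in d2.
rewrite distrC in d2; rewrite /= E in d1.
have := ltrD d1 d2; rewrite -splitr => /ltW; apply: le_trans.
by apply: le_trans (ler_normD _ _); rewrite addrA subrK.
Qed.

End smooth_functions.

(** * The Bessel operator on determinant polynomials *)

Section derivations.
Variables (A : comNzRingType) (dv : A -> A).
Hypothesis dvD : {morph dv : x y / x + y}.
Hypothesis dvM : forall x y, dv (x * y) = dv x * y + x * dv y.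

Lemma derivation0 : dv 0 = 0.
Proof. by apply: (addIr (dv 0)); rewrite -dvD !add0r. Qed.

Lemma derivation1 : dv 1 = 0.
Proof.
by apply: (addIr (dv 1)); rewrite add0r -[in RHS](mulr1 1) dvM mulr1 mul1r.
Qed.

Lemma derivationN x : dv (- x) = - dv x.
Proof. by apply: (addIr (dv x)); rewrite -dvD !addNr derivation0. Qed.

Lemma derivation_sign s x : dv ((-1) ^+ s * x) = (-1) ^+ s * dv x.
Proof.
have -> : (-1) ^+ s = (-1) ^+ odd s :> A by rewrite signr_odd.
by case: (odd s); rewrite ?mulN1r ?mul1r ?derivationN.
Qed.

Lemma derivation_sum (I : Type) (r : seq I) (F : I -> A) :
  dv (\sum_(i <- r) F i) = \sum_(i <- r) dv (F i).
Proof. by apply: (big_morph dv dvD); exact: derivation0. Qed.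

Lemma derivation_prod (I : eqType) (r : seq I) (F : I -> A) : uniq r ->
  dv (\prod_(i <- r) F i) =
  \sum_(i <- r) \prod_(j <- r) (if j == i then dv (F j) else F j).
Proof.
elim: r => [|a r IH] /=; first by rewrite !big_nil derivation1.
move=> /andP[ar ur]; rewrite !big_cons dvM IH// eqxx; congr (_ * _ + _).
  apply: eq_big_seq => j jr; case: eqP => // ja.
  by rewrite -ja jr in ar.
rewrite mulr_sumr; apply: eq_big_seq => i ir; rewrite big_cons.
by case: eqP => // ai; rewrite ai ir in ar.
Qed.

(** The product rule is grouped by rows, so that every summand is again a determinant and
    alternation can be applied to it. *)
Lemma derivation_det n (M : 'M[A]_n) :
  dv (\det M) = \sum_i \det (\matrix_(a, b) if a == i then dv (M a b) else M a b).
Proof.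
rewrite /determinant derivation_sum exchange_big /=; apply: eq_bigr => s _.
rewrite derivation_sign derivation_prod ?index_enum_uniq// mulr_sumr.
apply: eq_bigr => i _; congr (_ * _); apply: eq_bigr => a _; by rewrite mxE.
Qed.

Lemma derivation_exp (c : A) n x : dv x = c * x -> dv (x ^+ n) = (c * x ^+ n) *+ n.
Proof.
move=> dx; elim: n => [|n IH]; first by rewrite expr0 derivation1 mulr0n.
by rewrite exprS dvM dx IH -mulrA mulrS mulrnAr [x * (c * _)]mulrCA.
Qed.

End derivations.

(** Adding one variable at a time corresponds to applying one more field, so commutation relations
    can be propagated from single variables to all polynomials. *)
Lemma mpoly_ind1 (R : nzRingType) n (K : mpoly n R -> Prop) : K 0 -> K 1 ->
  (forall (c : R) p q, K p -> K q -> K (c *: p + q)) ->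
  (forall j p, K p -> K (mpolyX R (mnm1 j) * p)) -> forall p, K p.
Proof.
move=> K0 K1 KD KX; elim/mpolyind => // c m p _ _; apply: KD.
have [d] := ubnP (mdeg m); elim: d m => // d IH m; rewrite ltnS => md.
have [->|m0] := eqVneq m mnm0; first by rewrite mpolyX0.
have [j mj|z] := pickP (fun j => m j != 0%N); last first.
  case/eqP: m0; apply/mnmP => j; rewrite mnm0E; exact/eqP/negbFE/z.
have mE : m = mnm_add (mnm1 j) (mnm_sub m (mnm1 j)).
  apply/mnmP => l; rewrite mnmDE mnmBE mnm1E subnKC//.
  by case: eqP => // <-; rewrite lt0n.
rewrite mE mpolyXD; apply: KX; apply: IH.
by apply: leq_trans md; rewrite [in leqRHS]mE mdegD mdeg1.
Qed.

Section determinant_polynomial.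
Variables (R : comNzRingType) (k : nat).
Local Notation P := (mpoly (k * k) R).
Implicit Types (p q : P) (a b c e : 'I_k).

Definition var a b : P := mpolyX R (mnm1 (mxvec_index a b)).
Definition partial a b : P -> P := mderiv (mxvec_index a b).

Lemma mxvec_index_eq a b c e :
  (mxvec_index a b == mxvec_index c e) = (a == c) && (b == e).
Proof.
apply/eqP/andP => [E|[/eqP-> /eqP->]//].
have [f fK _] := curry_mxvec_bij k k.
have := fK (a, b) isT; rewrite /= E; have /= -> := fK (c, e) isT.
by case=> -> ->.
Qed.

Lemma partial_var a b c e : partial a b (var c e) = ((a == c) && (b == e))%:R.
Proof.
rewrite /partial /var mderivX mnm1E mxvec_index_eq [c == a]eq_sym [e == b]eq_sym.
case: andP => [[/eqP-> /eqP->]|_]; last by rewrite scale0r.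
rewrite scale1r (_ : mnm_sub _ _ = mnm0) ?mpolyX0//.
by apply/mnmP => l; rewrite mnmBE subnn mnm0E.
Qed.

Lemma partialM a b p q : partial a b (p * q) = partial a b p * q + p * partial a b q.
Proof. exact: mderivM. Qed.

HB.instance Definition _ a b := GRing.Linear.on (partial a b).

Definition detp : P := \det (\matrix_(a, b) var a b).

Definition polar a c p : P := \sum_e var a e * partial c e p.

Lemma polarD a c : {morph polar a c : p q / p + q}.
Proof.
move=> p q; rewrite /polar -big_split; apply: eq_bigr => e _.
by rewrite linearD mulrDr.
Qed.

Lemma polarM a c p q : polar a c (p * q) = polar a c p * q + p * polar a c q.
Proof.
rewrite /polar mulr_suml mulr_sumr -big_split; apply: eq_bigr => e _.
by rewrite partialM mulrDr mulrA mulrCA.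
Qed.

Lemma polar_var a c b e : polar a c (var b e) = (b == c)%:R * var a e.
Proof.
rewrite /polar (bigD1 e)//= big1 ?addr0 => [|l le].
  by rewrite partial_var eqxx andbT mulrC eq_sym.
by rewrite partial_var (negbTE le) andbF mulr0.
Qed.

(* [polar a c] replaces row [c] of the generic matrix by row [a]. *)
Lemma polar_det a c : polar a c detp = (a == c)%:R * detp.
Proof.
rewrite /detp (derivation_det (polarD a c) (polarM a c)) (bigD1 c)//=.
rewrite [X in _ + X]big1 ?addr0 => [|i ic].
  have [->|ac] := eqVneq a c.
    rewrite mul1r; congr (\det _); apply/matrixP => i j; rewrite !mxE.
    by case: eqP => // ->; rewrite polar_var eqxx mul1r.
  rewrite mul0r; apply: (determinant_alternate ac) => j.
  by rewrite !mxE eqxx (negbTE ac) polar_var eqxx mul1r.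
have Z : row i (\matrix_(a0, b) (if a0 == i then polar a c ((\matrix_(a1, b0) var a1 b0) a0 b)
     else (\matrix_(a1, b0) var a1 b0) a0 b)) = 0.
  apply/rowP => j; rewrite !mxE eqxx polar_var (negbTE ic) mul0r//.
rewrite (expand_det_row _ i) big1// => j _.
by move/rowP: Z => /(_ j); rewrite [LHS]mxE [RHS]mxE => ->; rewrite mul0r.
Qed.

Lemma polar_detX a c n : polar a c (detp ^+ n) = ((a == c)%:R * detp ^+ n) *+ n.
Proof. exact: (derivation_exp (polarM a c) n (polar_det a c)). Qed.

(* [hop] and [bessel] describe on polynomials [p] the effect on [p(M) f] of the
   fields of diag(-BZ, ZB) and of the upper unipotent B, where B and Z are the
   elementary matrices at (b0, a0) and (a, b). *)
Definition bessel (i : nat) a b p : P :=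
  (i%:R - k%:R) *: partial a b p -
  \sum_c \sum_e var c e * partial c b (partial a e p).

(** Pulling [partial c b] to the left of [var c e] turns the double sum into the sum of
    [partial c b (polar c a _)], minus one [partial a b] for each of the [k] values of [c]. Only
    [c = a] survives in [polar], and it gives [i] times [partial a b] of the power. *)
Lemma bessel_detX i a b : bessel i a b (detp ^+ i) = 0.
Proof.
apply/eqP; rewrite subr_eq0; apply/eqP.
transitivity (\sum_c (partial c b (polar c a (detp ^+ i)) - partial a b (detp ^+ i))).
  rewrite sumrB sumr_const card_ord scalerBl !scaler_nat; congr (_ - _).
  rewrite (bigD1 a)//= polar_detX eqxx mul1r big1 ?addr0 ?raddfMn// => c ca.
  by rewrite polar_detX (negbTE ca) mul0r mul0rn linear0.
apply: eq_bigr => c _; rewrite /polar linear_sum/=.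
under eq_bigr do rewrite partialM.
rewrite big_split/= [X in X + _ - _](_ : _ = partial a b (detp ^+ i)).
  by rewrite addrAC subrr add0r.
rewrite (bigD1 b)//= partial_var !eqxx mul1r big1 ?addr0// => e eb.
by rewrite partial_var [b == e]eq_sym (negbTE eb) andbF mul0r.
Qed.

(** The column analogue of [polar]: the derivation that replaces column [c] of the generic matrix by
    column [b]. *)
Definition polarc b c p : P := \sum_e var e b * partial e c p.

Lemma polarcM b c p q : polarc b c (p * q) = polarc b c p * q + p * polarc b c q.
Proof.
rewrite /polarc mulr_suml mulr_sumr -big_split; apply: eq_bigr => e _.
by rewrite partialM mulrDr mulrA mulrCA.
Qed.

Lemma polarc_var b c a e : polarc b c (var a e) = (e == c)%:R * var a b.
Proof.
rewrite /polarc (bigD1 a)//= big1 ?addr0 => [|l la].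
  by rewrite partial_var eqxx mulrC eq_sym.
by rewrite partial_var (negbTE la) mulr0.
Qed.

Definition hop (i : nat) a0 b0 a b p : P :=
  ((i%:R - k%:R) * ((a0 == a) && (b0 == b))%:R) *: p -
  ((a0 == a)%:R * polarc b b0 p + (b0 == b)%:R * polar a a0 p).

(** The correction is the commutator of the Levi field with the lower field of [var c e], in the
    shape that [low_diag_comm] produces. *)
Lemma hop_var i a0 b0 a b c e p : hop i a0 b0 a b (var c e * p) =
  var c e * hop i a0 b0 a b p -
  (((e == b0) && (a0 == a))%:R * var c b + ((b0 == b) && (c == a0))%:R * var a e) * p.
Proof.
rewrite /hop polarcM polarM polar_var polarc_var scalerAr -!mulnb !natrM; ring.
Qed.

(** Commuting a second-order operator with a multiplication leaves a first-order one. This mirrors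
    the bracket of an upper with a lower field, which lies in the Levi algebra. *)
Lemma bessel_var i a0 b0 a b p : bessel i a0 b0 (var a b * p) =
  var a b * bessel i a0 b0 p + hop i a0 b0 a b p.
Proof.
rewrite /bessel /hop partialM partial_var.
have -> : \sum_c \sum_e var c e * partial c b0 (partial a0 e (var a b * p)) =
    (a0 == a)%:R * polarc b b0 p + (b0 == b)%:R * polar a a0 p +
    var a b * \sum_c \sum_e var c e * partial c b0 (partial a0 e p).
  have E c e : var c e * partial c b0 (partial a0 e (var a b * p)) =
      (a0 == a)%:R * ((e == b)%:R * (var c e * partial c b0 p)) +
      (b0 == b)%:R * ((c == a)%:R * (var c e * partial a0 e p)) +
      var a b * (var c e * partial c b0 (partial a0 e p)).
    rewrite partialM partial_var linearD/= partialM partialM !partial_var -!mulnb !natrM.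
    (* A variable has constant first derivatives, so no term arises in which both derivatives hit
       it. *)
    rewrite (_ : partial c b0 ((a0 == a)%:R * (e == b)%:R) = 0); last first.
      by rewrite -natrM -[_%:R]mulr1 mulr_natl linearMn/= -[1]mpolyX0 /partial
        mderivX mnm0E scale0r mul0rn.
    ring.
  under eq_bigr do under eq_bigr do rewrite E.
  under eq_bigr do rewrite !big_split/= -!mulr_sumr.
  rewrite !big_split/= -!mulr_sumr; congr (_ * _ + _ * _ + _).
    apply: eq_bigr => c _; rewrite (bigD1 b)//= eqxx mul1r big1 ?addr0// => e.
    by move=> /negbTE->; rewrite mul0r.
  rewrite (bigD1 a)//= eqxx mul1r [X in _ + X]big1 ?addr0.
    by [].
  by move=> c /negbTE->; rewrite mul0r.
rewrite scalerDr -scalerA scaler_nat mulr_natl mulrBr scalerAr; ring.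
Qed.

Lemma hop_lin i a0 b0 a b (c : R) p q : hop i a0 b0 a b (c *: p + q) =
  c *: hop i a0 b0 a b p + hop i a0 b0 a b q.
Proof.
have polarcP : polarc b b0 (c *: p + q) = c *: polarc b b0 p + polarc b b0 q.
  rewrite /polarc scaler_sumr -big_split; apply: eq_bigr => e _.
  by rewrite linearP mulrDr -scalerAr.
have polarP : polar a a0 (c *: p + q) = c *: polar a a0 p + polar a a0 q.
  rewrite /polar scaler_sumr -big_split; apply: eq_bigr => e _.
  by rewrite linearP mulrDr -scalerAr.
rewrite /hop polarcP polarP scalerBr scalerDr scalerDr !scalerA (mulrC _ c).
rewrite !mulrDr -!scalerAr; ring.
Qed.

Lemma hop1 i a0 b0 a b :
  hop i a0 b0 a b 1 = ((i%:R - k%:R) * ((a0 == a) && (b0 == b))%:R) *: 1.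
Proof.
have p1 c e : partial c e 1 = 0.
  by rewrite -[1]mpolyX0 /partial mderivX mnm0E scale0r.
rewrite /hop /polar /polarc !big1 ?mulr0 ?addr0 ?subr0// => e _;
  by rewrite p1 mulr0.
Qed.

Lemma bessel_lin i a b (c : R) p q :
  bessel i a b (c *: p + q) = c *: bessel i a b p + bessel i a b q.
Proof.
have E : \sum_d \sum_e var d e * partial d b (partial a e (c *: p + q)) =
    c *: (\sum_d \sum_e var d e * partial d b (partial a e p)) +
    \sum_d \sum_e var d e * partial d b (partial a e q).
  rewrite scaler_sumr -big_split; apply: eq_bigr => d _.
  rewrite scaler_sumr -big_split; apply: eq_bigr => e _.
  by rewrite !linearP mulrDr -scalerAr.
rewrite /bessel E linearP scalerDr scalerBr !scalerA (mulrC c); ring.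
Qed.

Lemma bessel1 i a b : bessel i a b 1 = 0.
Proof.
have p1 c e : partial c e 1 = 0.
  by rewrite -[1]mpolyX0 /partial mderivX mnm0E scale0r.
rewrite /bessel p1 scaler0 big1 ?subr0// => c _; rewrite big1// => e _.
by rewrite p1 linear0 mulr0.
Qed.

(** Homogeneity is what singles out one order of differentiation in [act_low_eval_gt0]. *)
Lemma detp_homog : detp \is ishomog1 k mdeg.
Proof.
rewrite /detp /determinant rpred_sum// => s _.
have pr (r : seq 'I_k) : \prod_(i <- r) (\matrix_(a, b) var a b) i (s i)
    \is ishomog1 (size r) mdeg.
  elim: r => [|a r IH]; first by rewrite big_nil dhomog1.
  by rewrite big_cons mxE; apply: (dhomogM (d := 1)) => //; rewrite dhomogX /= mdeg1.
have {pr} : \prod_i (\matrix_(a, b) var a b) i (s i) \is ishomog1 k mdeg.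
  have := pr (index_enum 'I_k); rewrite (_ : size _ = k)//.
  by rewrite -[index_enum _]enumT size_enum_ord.
by rewrite mulr_sign; case: ifP => // _; rewrite rpredN.
Qed.

Lemma meval_detp v : meval v detp = \det (\matrix_(a, b) v (mxvec_index a b)).
Proof.
rewrite /detp -det_map_mx; congr (\det _); apply/matrixP => a b.
by rewrite !mxE; exact: mevalXU.
Qed.

Lemma detp_neq0 : detp != 0.
Proof.
apply/eqP => d0; have := meval_detp (fun j => (mxvec 1%:M) 0 j).
rewrite d0 meval0 (_ : \matrix_(_, _) _ = 1%:M) ?det1.
  by move/eqP; rewrite eq_sym oner_eq0.
by apply/matrixP => a b; rewrite mxE mxvecE.
Qed.

(** Conjugating the lower fields by a group element changes the polynomial acting through them by
    such a substitution; see [act_comp]. *)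
Definition subst (M : 'M[P]_k) : P -> P :=
  comp_mpoly [tuple (mxvec M) 0 j | j < k * k].

Lemma subst_mxvec M a b : subst M (var a b) = M a b.
Proof.
by rewrite /subst /var comp_mpolyXU (nth_map (mxvec_index a b))
  ?size_enum_ord// nth_ord_enum mxvecE.
Qed.

HB.instance Definition _ M := GRing.RMorphism.on (subst M).
HB.instance Definition _ M := GRing.Linear.on (subst M).

Lemma subst_detp M : subst M detp = \det M.
Proof.
rewrite /detp -det_map_mx; congr (\det _); apply/matrixP => a b.
by rewrite !mxE; exact: subst_mxvec.
Qed.

End determinant_polynomial.

(** * Left translation fields *)

Section left_fields.
Variables (R : realType) (n : nat).
Local Notation V := 'M[R]_n.
Local Notation U := [set x : V | x \in unitmx].
Implicit Types (X Y v w y : V) (f g h : V -> R).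

Let oU : open U. Proof. exact: open_unitmx. Qed.

Lemma mx_continuous (L : V -> V) :
  (forall i j, continuous (fun x => L x i j)) -> continuous L.
Proof.
move=> cL x A [B nB BA]; rewrite nbhs_simpl.
have : \forall y \near x, forall i j, B i j (L y i j).
  apply: (@filter_forall _ 'I_n
    (fun i y => forall j, B i j (L y i j)) (nbhs x) _) => i.
  apply: (@filter_forall _ 'I_n
    (fun j y => B i j (L y i j)) (nbhs x) _) => j.
  exact: (cL i j x _ (nB i j)).
by move=> H; apply: filterS H => y yB; apply: BA.
Qed.

Definition lcoef X i j : V -> R := fun y => (X *m y) i j.

Lemma lcoef_is_linear X i j : linear (lcoef X i j).
Proof. by move=> a u v; rewrite /lcoef mulmxDr -scalemxAr !mxE. Qed.
HB.instance Definition _ X i j :=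
  GRing.isLinear.Build R V R _ (lcoef X i j) (lcoef_is_linear X i j).

Lemma lcoef_continuous X i j : continuous (lcoef X i j).
Proof.
rewrite (_ : lcoef X i j = fun y => \sum_l X i l * y l j); last first.
  by apply/funext => y; rewrite /lcoef mxE.
apply: sum_continuous => l y.
apply: (@continuousM _ _ (cst (X i l))); first exact: cst_continuous.
exact: coord_continuous.
Qed.

Lemma mulmx_continuous X : continuous (mulmx X : V -> V).
Proof. by apply: mx_continuous => i j; exact: lcoef_continuous. Qed.

Lemma smooth_on_lcoef X i j : smooth_on U (lcoef X i j).
Proof. by apply: smooth_on_linear => //; exact: lcoef_continuous. Qed.

Lemma smooth_on_coord i j : smooth_on U (fun y : V => y i j).
Proof.
apply: eq_smooth_on (smooth_on_lcoef 1%:M i j) => // y _.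
by rewrite /lcoef mul1mx.
Qed.

Lemma derive_linearl h y (a : R) v w : differentiable h y ->
  'D_(a *: v + w) h y = a * 'D_v h y + 'D_w h y.
Proof. by move=> dh; rewrite !deriveE// linearP. Qed.

Lemma derive_coord h y v : differentiable h y ->
  'D_v h y = \sum_i \sum_j v i j * 'D_(delta_mx i j) h y.
Proof.
move=> dh; rewrite {1}(matrix_sum_delta v) deriveE// linear_sum.
apply: eq_bigr => i _; rewrite linear_sum; apply: eq_bigr => j _.
by rewrite linearZ -deriveE.
Qed.

Lemma derive_bigsum (I : Type) (r : seq I) (F : I -> V -> R) y v :
  (forall i, differentiable (F i) y) ->
  differentiable (fun x => \sum_(i <- r) F i x) y /\
  'D_v (fun x => \sum_(i <- r) F i x) y = \sum_(i <- r) 'D_v (F i) y.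
Proof.
move=> dF; elim: r => [|a r [dr IH]].
  rewrite (_ : (fun x => _) = cst 0); last first.
    by apply/funext => x; rewrite big_nil.
  by rewrite big_nil derive_cst.
rewrite (_ : (fun x => _) = F a + (fun x => \sum_(i <- r) F i x)); last first.
  by apply/funext => x; rewrite big_cons.
rewrite deriveD ?IH ?big_cons; try exact: diff_derivable.
by split=> //; exact: differentiableD.
Qed.

Lemma eq_derive_on f g v y : (forall x, U x -> f x = g x) -> U y ->
  'D_v f y = 'D_v g y.
Proof.
move=> fg Uy; apply: near_eq_derive.
by apply: filterS (open_nbhs_nbhs (conj oU Uy)) => x /fg.
Qed.

Lemma derive_lin_on f g (a : R) v y : smooth_on U f -> smooth_on U g -> U y ->
  'D_v (fun x => a * f x + g x) y = a * 'D_v f y + 'D_v g y.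
Proof.
move=> sf sg Uy; have df := smooth_on_diff sf Uy; have dg := smooth_on_diff sg Uy.
rewrite (_ : (fun x => _) = a *: f + g)//.
rewrite deriveD; try exact: diff_derivable; last first.
  exact/derivableZ/diff_derivable.
by rewrite deriveZ//; exact: diff_derivable.
Qed.

Lemma deriveM_on f g v y : smooth_on U f -> smooth_on U g -> U y ->
  'D_v (fun x => f x * g x) y = 'D_v f y * g y + f y * 'D_v g y.
Proof.
move=> sf sg Uy; rewrite (_ : (fun x => _) = f * g)// deriveM.
- by rewrite addrC mulrC.
- exact/diff_derivable/smooth_on_diff.
- exact/diff_derivable/smooth_on_diff.
Qed.

(** The vector field y -> X y, which generates left translation by exp(tX) and is therefore
    invariant under right translation. *)
Definition lfield X h : V -> R := fun y => 'D_(X *m y) h y.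

Lemma lfieldE X h y : lfield X h y = 'D_(X *m y) h y.
Proof. by []. Qed.

Lemma lfield_coord X h y : smooth_on U h -> U y ->
  lfield X h y = \sum_i \sum_j lcoef X i j y * 'D_(delta_mx i j) h y.
Proof. by move=> sh Uy; rewrite /lfield derive_coord//; exact: smooth_on_diff. Qed.

Lemma smooth_on_lfield X h : smooth_on U h -> smooth_on U (lfield X h).
Proof.
move=> sh.
have sS : smooth_on U
    (fun y => \sum_i \sum_j lcoef X i j y * 'D_(delta_mx i j) h y).
  apply: smooth_on_sum => // i; apply: smooth_on_sum => // j.
  by apply: smooth_onM (smooth_on_lcoef _ _ _) (smooth_on_derive _ sh).
by apply: eq_smooth_on sS => // y Uy; rewrite lfield_coord.
Qed.

Lemma eq_lfield X f g y : (forall x, U x -> f x = g x) -> U y ->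
  lfield X f y = lfield X g y.
Proof. exact: eq_derive_on. Qed.

Lemma lfield_lin X f g (a : R) y : smooth_on U f -> smooth_on U g -> U y ->
  lfield X (fun x => a * f x + g x) y = a * lfield X f y + lfield X g y.
Proof. exact: derive_lin_on. Qed.

Lemma lfield0 X y : lfield X (fun=> 0) y = 0.
Proof. exact: derive_cst. Qed.

Lemma lfield0l h y : lfield 0 h y = 0.
Proof. by rewrite /lfield mul0mx derive0. Qed.

Lemma lfieldP X Y h (a : R) y : smooth_on U h -> U y ->
  lfield (a *: X + Y) h y = a * lfield X h y + lfield Y h y.
Proof.
move=> sh Uy; rewrite /lfield mulmxDl -scalemxAl derive_linearl//.
exact: smooth_on_diff.
Qed.

(** The product rule for a field with linear coefficients: one term differentiates the coefficient
    [X *m y], the other keeps it frozen. *)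
Lemma derive_lfield X h v y : smooth_on U h -> U y ->
  'D_v (lfield X h) y = 'D_(X *m v) h y + 'D_v ('D_(X *m y) h) y.
Proof.
move=> sh Uy; have sD w : smooth_on U ('D_w h) by exact: smooth_on_derive.
have sc := smooth_on_lcoef X.
pose E (p : 'I_n * 'I_n) : V -> R := 'D_(delta_mx p.1 p.2) h.
have sE p : smooth_on U (E p) by exact: sD.
have dE p : differentiable (E p) y by exact: smooth_on_diff.
have -> : 'D_v (lfield X h) y =
    'D_v (fun x => \sum_p lcoef X p.1 p.2 x * E p x) y.
  apply: eq_derive_on => // x Ux.
  by rewrite lfield_coord// pair_big.
have -> : 'D_v ('D_(X *m y) h) y =
    'D_v (fun x => \sum_p lcoef X p.1 p.2 y * E p x) y.
  apply: eq_derive_on => // x Ux.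
  by rewrite derive_coord ?pair_big//; exact: smooth_on_diff.
rewrite (derive_bigsum _ _ _).2 => [|p]; last first.
  by apply: smooth_on_diff Uy; exact: smooth_onM.
rewrite (derive_bigsum _ _ _).2 => [|p]; last first.
  by apply: smooth_on_diff Uy; apply: smooth_onM => //; exact: smooth_on_cst.
rewrite derive_coord; last exact: smooth_on_diff.
rewrite pair_big -big_split; apply: eq_bigr => p _ /=.
rewrite deriveM_on// derive_linear; last exact: lcoef_continuous.
rewrite deriveM_on//; last exact: smooth_on_cst.
by rewrite (derive_cst (lcoef X p.1 p.2 y)) mul0r add0r.
Qed.

(** The second-order terms cancel by [derive_comm], and only the derivatives of the coefficients
    remain. The bracket is opposite to that of matrices, as usual for generators of left
    translations. *)
Lemma lfield_comm X Y h y : smooth_on U h -> U y ->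
  lfield X (lfield Y h) y =
  lfield Y (lfield X h) y + lfield (Y *m X - X *m Y) h y.
Proof.
move=> sh Uy.
have E1 : lfield X (lfield Y h) y = _ := derive_lfield Y (X *m y) sh Uy.
have E2 : lfield Y (lfield X h) y = _ := derive_lfield X (Y *m y) sh Uy.
have E3 : lfield (Y *m X - X *m Y) h y =
    'D_(Y *m (X *m y)) h y - 'D_(X *m (Y *m y)) h y.
  rewrite /lfield mulmxBl -scaleN1r addrC derive_linearl; last first.
    exact: smooth_on_diff sh Uy.
  by rewrite !mulmxA mulN1r addrC.
rewrite {}E1 {}E2 {}E3 (derive_comm oU (Y *m y) (X *m y) sh Uy).
have abc (a b c : R) : a + b = c + b + (a - c) by ring.
exact: abc.
Qed.

Lemma lfield_commute X Y h y : X *m Y = Y *m X -> smooth_on U h -> U y ->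
  lfield X (lfield Y h) y = lfield Y (lfield X h) y.
Proof.
move=> XY sh Uy; rewrite (lfield_comm X Y sh Uy) XY subrr.
by rewrite lfield0l addr0.
Qed.

Lemma lfield_comp (L : {linear V -> V}) X Y h y : continuous L ->
  smooth_on U h -> U (L y) -> L (X *m y) = Y *m L y ->
  lfield X (h \o L) y = lfield Y h (L y).
Proof.
move=> cL sh ULy LX; have dh := smooth_on_diff sh ULy.
have dL : differentiable L y by exact: linear_differentiable.
rewrite /lfield (deriveE _ (differentiable_comp dL dh)) (diff_comp dL dh) /=.
by rewrite (diff_lin y cL) -deriveE// LX.
Qed.

End left_fields.
Opaque lfield.

(** * Polynomials in commuting fields *)

Section polynomials_in_fields.
Variables (R : realType) (n N : nat) (F : 'I_N -> 'M[R]_n).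
Local Notation V := 'M[R]_n.
Local Notation U := [set x : V | x \in unitmx].
Implicit Types (y : V) (f g h : V -> R) (p q : mpoly N R) (s : seq 'I_N).

Hypothesis FC : forall i j, F i *m F j = F j *m F i.
Let oU : open U. Proof. exact: open_unitmx. Qed.

Definition fields s h := foldr (fun j g => lfield (F j) g) h s.

Lemma smooth_on_fields s h : smooth_on U h -> smooth_on U (fields s h).
Proof. by move=> sh; elim: s => //= j s; exact: smooth_on_lfield. Qed.

Lemma fields_perm s1 s2 h y : smooth_on U h -> perm_eq s1 s2 -> U y ->
  fields s1 h y = fields s2 h y.
Proof.
move=> sh.
have rem_head s x z : x \in s -> U z -> fields s h z = fields (x :: rem x s) h z.
  elim: s z => [|a s IH] z //; rewrite in_cons /=.
  case: eqVneq => [->|ax] //= xs Uz.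
  transitivity (lfield (F a) (fields (x :: rem x s) h) z).
    by apply: eq_lfield => // t Ut; exact: IH.
  exact: (lfield_commute (FC a x) (smooth_on_fields _ sh) Uz).
elim: s1 s2 y => [|x s1 IH] s2 y.
  by rewrite perm_sym => /perm_small_eq ->.
move=> s12 Uy; have xs2 : x \in s2 by rewrite -(perm_mem s12) mem_head.
rewrite (rem_head _ _ _ xs2 Uy) /=; apply: eq_lfield => // z Uz.
apply: IH => //; rewrite -(perm_cons x).
by rewrite (permPl s12) perm_to_rem.
Qed.

(** The operator p(F). A monomial acts through the list of its variables with multiplicity; for
    commuting fields the order in that list is immaterial by [fields_perm]. *)
Definition act p h : V -> R :=
  fun y => \sum_(m <- msupp p) mcoeff m p * fields (m2s m) h y.

(** A common finite range of monomials makes the sums attached to different polynomials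
    comparable. *)
Lemma act_wide p h y i : (mmeasure mdeg p <= i)%N ->
  act p h y = \sum_(m : bmultinom N i) mcoeff m p * fields (m2s m) h y.
Proof.
move=> le_pi; set I : subFinType _ := bmultinom N i.
rewrite /act (big_mksub I) ?msupp_uniq //=; first last.
  by move=> x /msize_mdeg_lt /leq_trans; apply.
rewrite big_rmcond //= => j /memN_msupp_eq0 ->.
by rewrite mul0r.
Qed.

Lemma act_lin (c : R) p q h y : act (c *: p + q) h y = c * act p h y + act q h y.
Proof.
pose i := maxn (mmeasure mdeg (c *: p + q)) (maxn (mmeasure mdeg p) (mmeasure mdeg q)).
rewrite !(act_wide _ _ (i := i)) ?leq_max ?leqnn ?orbT//.
rewrite mulr_sumr -big_split; apply: eq_bigr => m _ /=.
by rewrite mcoeffD mcoeffZ mulrDl mulrA.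
Qed.

Lemma act0 h y : act 0 h y = 0.
Proof. by rewrite /act msupp0 big_nil. Qed.

Lemma actZ (c : R) p h y : act (c *: p) h y = c * act p h y.
Proof. by rewrite -[c *: p]addr0 act_lin act0 addr0. Qed.

Lemma actD p q h y : act (p + q) h y = act p h y + act q h y.
Proof. by rewrite -[p]scale1r act_lin scale1r mul1r. Qed.

Lemma actN p h y : act (- p) h y = - act p h y.
Proof. by rewrite -scaleN1r actZ mulN1r. Qed.

Lemma act_sum (I : Type) (r : seq I) (G : I -> mpoly N R) h y :
  act (\sum_(i <- r) G i) h y = \sum_(i <- r) act (G i) h y.
Proof. by apply: (big_morph (fun p => act p h y)) => [p q|]; rewrite (actD, act0). Qed.

Lemma act_mon m h y : act (mpolyX R m) h y = fields (m2s m) h y.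
Proof. by rewrite /act msuppX big_seq1 mcoeffX eqxx mul1r. Qed.

Lemma act1 h y : act 1 h y = h y.
Proof.
rewrite -mpolyX0 act_mon /m2s (eq_map (_ : _ =1 fun=> [::])); first by elim: (enum _).
by move=> i /=; rewrite mnm0E.
Qed.

Lemma smooth_on_act p h : smooth_on U h -> smooth_on U (act p h).
Proof.
move=> sh; apply: smooth_on_sum => // m; apply: smooth_onM => //.
  exact: smooth_on_cst.
exact: smooth_on_fields.
Qed.

Lemma actX j p h y : smooth_on U h -> U y ->
  act (mpolyX R (mnm1 j) * p) h y = lfield (F j) (act p h) y.
Proof.
move=> sh; elim/mpolyind: p y => [|c m p _ _ IH] y Uy.
  by rewrite mulr0 act0 -(lfield0 (F j) y); apply: eq_lfield => // z _; rewrite act0.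
transitivity (lfield (F j) (fun z => c * fields (m2s m) h z + act p h z) y);
  last by apply: eq_lfield => // z _; rewrite act_lin act_mon.
rewrite lfield_lin//; [|exact: smooth_on_fields|exact: smooth_on_act].
rewrite mulrDr -scalerAr act_lin IH// -mpolyXD act_mon; congr (_ * _ + _).
(* The product monomial lists [j] at its own place rather than in front; both lists contain each
   variable equally often. *)
rewrite (@fields_perm _ (j :: m2s m))//; apply/seq.permP => /= a.
have cm (m0 : multinom N) : count a (m2s m0) = (\sum_i m0 i * a i)%N.
  rewrite /m2s count_flatten sumnE !big_map.
  by apply: eq_bigr => i _; rewrite count_nseq mulnC.
rewrite !cm (eq_bigr (fun i => (mnm1 j i * a i + m i * a i)%N)) => [|i _].
  rewrite big_split/=; congr addn; rewrite (bigD1 j)//= mnm1E eqxx mul1n.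
  by rewrite big1 ?addn0// => i ij; rewrite mnm1E eq_sym (negbTE ij).
by rewrite mnmDE mulnDl.
Qed.

Lemma eq_act p f g y : (forall x, U x -> f x = g x) -> U y -> act p f y = act p g y.
Proof.
move=> fg Uy; apply: eq_bigr => m _; congr (_ * _).
elim: (m2s m) y Uy => [|j s IH] y Uy /=; first exact: fg.
exact: eq_lfield.
Qed.

Lemma act_linr p f g (a : R) y : smooth_on U f -> smooth_on U g -> U y ->
  act p (fun x => a * f x + g x) y = a * act p f y + act p g y.
Proof.
move=> sf sg; elim/mpoly_ind1: p y => [||c p q IHp IHq|j p IH] y Uy.
- by rewrite !act0 mulr0 addr0.
- by rewrite !act1.
- by rewrite !act_lin IHp// IHq//; ring.
- have sfg : smooth_on U (fun x => a * f x + g x).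
    by apply: smooth_onD => //; apply: smooth_onM => //; exact: smooth_on_cst.
  rewrite !actX// -lfield_lin//; try exact: smooth_on_act.
  exact: eq_lfield.
Qed.

Lemma actZr p f (a : R) y : smooth_on U f -> U y ->
  act p (fun x => a * f x) y = a * act p f y.
Proof.
move=> sf Uy; have s0 : smooth_on U (fun=> 0 : R) by exact: smooth_on_cst.
have a0 : act p (fun=> 0) y = 0.
  have H := act_linr p (-1) s0 s0 Uy; rewrite mulr0 addr0 in H.
  by rewrite [LHS]H mulN1r addNr.
rewrite -[RHS]addr0 -a0 -act_linr//.
by apply: eq_act => // x _; rewrite addr0.
Qed.

End polynomials_in_fields.

(** * Commutation relations for the Siegel parabolic *)

Section siegel_parabolic.
Variables (R : realType) (k : nat).
Local Notation V := 'M[R]_(k + k).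
Local Notation U := [set x : V | x \in unitmx].
Local Notation P := (mpoly (k * k) R).
Implicit Types (f g h : V -> R) (y : V) (p q : P).

Let oU : open U. Proof. exact: open_unitmx. Qed.

Definition lowN (Z : 'M[R]_k) : V := block_mx 0 0 Z 0.
Definition upN (B : 'M[R]_k) : V := block_mx 0 B 0 0.
Definition diagN (A D : 'M[R]_k) : V := block_mx A 0 0 D.

Lemma lowN_linear (c : R) Z W : lowN (c *: Z + W) = c *: lowN Z + lowN W.
Proof. by rewrite /lowN scale_block_mx add_block_mx !scaler0 !addr0. Qed.

Definition lowF (j : 'I_(k * k)) : V := lowN (vec_mx (delta_mx 0 j)).

Lemma lowF_index a b : lowF (mxvec_index a b) = lowN (delta_mx a b).
Proof. by rewrite /lowF vec_mx_delta. Qed.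

Lemma lowN_mul Z W : lowN Z *m lowN W = 0.
Proof. by rewrite mulmx_block !mul0mx !mulmx0 !addr0 /block_mx !row_mx0 col_mx0. Qed.

Lemma lowFC i j : lowF i *m lowF j = lowF j *m lowF i.
Proof. by rewrite !lowN_mul. Qed.

Lemma low_up_comm Z B : lowN Z *m upN B - upN B *m lowN Z = diagN (- (B *m Z)) (Z *m B).
Proof.
rewrite /lowN /upN /diagN !mulmx_block !mul0mx !mulmx0 !addr0 !add0r.
by rewrite opp_block_mx add_block_mx !oppr0 !addr0 !add0r.
Qed.

Lemma low_diag_comm Z A D :
  lowN Z *m diagN A D - diagN A D *m lowN Z = lowN (Z *m A - D *m Z).
Proof.
rewrite /lowN /diagN !mulmx_block !mul0mx !mulmx0 !addr0 !add0r.
by rewrite opp_block_mx add_block_mx !oppr0 !addr0.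
Qed.

Lemma delta_mx_mul3 (a b c d e l : 'I_k) : delta_mx a b *m (delta_mx c d *m delta_mx e l) =
  ((b == c) && (d == e))%:R *: delta_mx a l :> 'M[R]_k.
Proof.
rewrite mul_delta_mx_cond; case: (d == e); last by rewrite andbF mulmx0 scale0r.
rewrite andbT mul_delta_mx_cond; case: (b == c); first by rewrite scale1r.
by rewrite scale0r.
Qed.

Local Notation act := (act lowF).

Lemma act_var a b p h y : smooth_on U h -> U y ->
  act (var R a b * p) h y = lfield (lowN (delta_mx a b)) (act p h) y.
Proof. by move=> sh Uy; rewrite -lowF_index; exact: (actX lowFC). Qed.

Section infinitesimal.
Variables (i : nat) (a0 b0 : 'I_k) (f : V -> R).
Local Notation B := (delta_mx b0 a0 : 'M[R]_k).
Local Notation H a b := (diagN (- (B *m delta_mx a b)) (delta_mx a b *m B)).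
Hypothesis sf : smooth_on U f.
Hypothesis upf : forall y, U y -> lfield (upN B) f y = 0.
Hypothesis diagf : forall a b y, U y ->
  lfield (H a b) f y = (i%:R - k%:R) * ((a0 == a) && (b0 == b))%:R * f y.

(** The Levi field acts on [f] by a scalar. Moving it inwards past each lower field costs a
    commutator that is again a lower field, hence a multiplication on polynomials. *)
Lemma lfield_diag_act a b p y : U y ->
  lfield (H a b) (act p f) y = act (hop i a0 b0 a b p) f y.
Proof.
elim/mpoly_ind1: p y => [||c p q IHp IHq|j p IH] y Uy.
- have -> : hop i a0 b0 a b 0 = 0 :> P.
    by have := hop_lin i a0 b0 a b (-1) (0 : P) 0; rewrite scaler0 addr0 scaleN1r addNr.
  rewrite act0 -(lfield0 (H a b) y); apply: eq_lfield => // z _; exact: act0.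
- rewrite hop1 actZ act1 -diagf//; apply: eq_lfield => // z _; exact: act1.
- rewrite hop_lin act_lin -IHp// -IHq//.
  rewrite -lfield_lin//; try exact: smooth_on_act.
  by apply: eq_lfield => // z _; exact: act_lin.
case/mxvec_indexP: j => c e; rewrite -/(var R c e).
transitivity (lfield (H a b) (lfield (lowN (delta_mx c e)) (act p f)) y).
  by apply: eq_lfield => // z Uz; exact: act_var.
have sa q : smooth_on U (act q f) by exact: smooth_on_act.
rewrite (lfield_comm _ _ (sa p) Uy) low_diag_comm.
have -> : lfield (lowN (delta_mx c e)) (lfield (H a b) (act p f)) y =
    act (var R c e * hop i a0 b0 a b p) f y.
  by rewrite act_var//; exact: eq_lfield.
rewrite hop_var actD actN mulrDl actD; congr (_ + _).
(* The final [+ 0] puts both summands in the form [a *: X + Y] required by [lowN_linear] and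
   [lfieldP]. *)
have -> : delta_mx c e *m - (B *m delta_mx a b) - delta_mx a b *m B *m delta_mx c e =
    - ((e == b0) && (a0 == a))%:R *: delta_mx c b +
    (- ((b0 == b) && (c == a0))%:R *: delta_mx a e + 0) :> 'M[R]_k.
  rewrite mulmxN -mulmxA !delta_mx_mul3 addr0 !scaleNr.
  by rewrite (eq_sym b) (eq_sym a0 c).
have natr_act (s : nat) q : act (s%:R * q) f y = s%:R * act q f y.
  by rewrite mulr_natl -scaler_nat actZ.
rewrite !lowN_linear !lfieldP// -!act_var// -!mulrA !natr_act.
have -> : lfield (lowN 0) (act p f) y = 0.
  by rewrite /lowN block_mx0 lfield0l.
by rewrite addr0 !mulNr opprD.
Qed.

(** The upper field kills [f], so only its commutators with the lower fields contribute. These are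
    Levi fields, and [lfield_diag_act] evaluates them. *)
Lemma lfield_up_act p y : U y ->
  lfield (upN B) (act p f) y = act (bessel i a0 b0 p) f y.
Proof.
elim/mpoly_ind1: p y => [||c p q IHp IHq|j p IH] y Uy.
- have -> : bessel i a0 b0 0 = 0 :> P.
    by have := bessel_lin i a0 b0 (-1) (0 : P) 0; rewrite scaler0 addr0 scaleN1r addNr.
  rewrite act0 -(lfield0 (upN B) y); apply: eq_lfield => // z _; exact: act0.
- rewrite bessel1 act0 -(upf Uy); apply: eq_lfield => // z _; exact: act1.
- rewrite bessel_lin act_lin -IHp// -IHq//.
  rewrite -lfield_lin//; try exact: smooth_on_act.
  by apply: eq_lfield => // z _; exact: act_lin.
case/mxvec_indexP: j => c e; rewrite -/(var R c e).
transitivity (lfield (upN B) (lfield (lowN (delta_mx c e)) (act p f)) y).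
  by apply: eq_lfield => // z Uz; exact: act_var.
have sa q : smooth_on U (act q f) by exact: smooth_on_act.
rewrite (lfield_comm _ _ (sa p) Uy) low_up_comm lfield_diag_act// bessel_var [RHS]actD.
by congr (_ + _); rewrite act_var//; exact: eq_lfield.
Qed.

Lemma lfield_up_det y : U y -> lfield (upN B) (act (detp R k ^+ i) f) y = 0.
Proof. by move=> Uy; rewrite lfield_up_act// bessel_detX act0. Qed.

End infinitesimal.
End siegel_parabolic.

(** * From vector fields to group translations *)

Section integrated_equivariance.
Variables (R : realType) (k : nat).
Local Notation V := 'M[R]_(k + k).
Local Notation U := [set x : V | x \in unitmx].
Local Notation P := (mpoly (k * k) R).
Implicit Types (f g h : V -> R) (y : V) (p q : P).
Local Notation act := (act (@lowF R k)).

Let oU : open U. Proof. exact: open_unitmx. Qed.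

Lemma upN_linear (c : R) (B C : 'M[R]_k) : upN (c *: B + C) = c *: upN B + upN C.
Proof. by rewrite /upN scale_block_mx add_block_mx !scaler0 !addr0. Qed.

Lemma upN_mul (B C : 'M[R]_k) : upN B *m upN C = 0.
Proof. by rewrite mulmx_block !mul0mx !mulmx0 !addr0 block_mx0. Qed.

Lemma upN_add1 (B : 'M[R]_k) y : y + upN B *m y = block_mx 1%:M B 0 1%:M *m y.
Proof.
rewrite -{1}(mul1mx y) -mulmxDl scalar_mx_block add_block_mx.
by rewrite !addr0 !add0r.
Qed.

Lemma upN_unit (B : 'M[R]_k) y : U y -> U (y + upN B *m y).
Proof.
by move=> Uy; rewrite upN_add1 /= unitmx_mul unitmxE det_ublock !det1 mulr1 unitr1.
Qed.

(** Products of matrices [upN] vanish. Hence translations by them add up, and along the line y + tXy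
    the direction Xy is the value of the field at every point, so [h] has derivative zero there. *)
Lemma upN_invariant h : smooth_on U h ->
  (forall a b y, U y -> lfield (upN (delta_mx a b)) h y = 0) ->
  forall B y, U y -> h (y + upN B *m y) = h y.
Proof.
move=> sh h0 B; rewrite (matrix_sum_delta B).
have step C1 C2 : (forall y, U y -> h (y + upN C1 *m y) = h y) ->
    (forall y, U y -> h (y + upN C2 *m y) = h y) ->
    forall y, U y -> h (y + upN (C1 + C2) *m y) = h y.
  move=> H1 H2 y Uy; rewrite -(H2 y Uy) -(H1 _ (upN_unit C2 Uy)); congr h.
  rewrite -[C1]scale1r upN_linear !scale1r mulmxDl mulmxDr mulmxA upN_mul.
  by rewrite mul0mx addr0 -addrA [upN C2 *m y + _]addrC.
have base : forall y, U y -> h (y + upN (0 : 'M[R]_k) *m y) = h y.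
  by move=> y Uy; rewrite /upN block_mx0 mul0mx addr0.
apply: (@big_rec _ (fun C => forall y, U y -> h (y + upN C *m y) = h y)) => //.
move=> a C _ IH; apply: (step) => // {C IH}.
apply: (@big_rec _ (fun C => forall y, U y -> h (y + upN C *m y) = h y)) => //.
move=> b C _ IH; apply: (step) => // {C IH} y Uy.
pose v := upN (delta_mx a b) *m y.
have -> : upN (B a b *: delta_mx a b) *m y = B a b *: v.
  by rewrite -[_ *: delta_mx a b]addr0 upN_linear {2}/upN block_mx0 addr0 -scalemxAl.
have dv t : is_derive t (1 : R) (fun s : R => h (y + s *: v)) 0.
  have Ut : U (y + t *: v).
    rewrite /v scalemxAl -[t *: upN _]addr0 -(block_mx0 R k k k k) -[block_mx _ _ _ _]/(upN 0).
    by rewrite -upN_linear; exact: upN_unit.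
  have D0 : 'D_v h (y + t *: v) = 0.
    rewrite -(h0 a b _ Ut) lfieldE; congr ('D__ h _).
    by rewrite mulmxDr -scalemxAr /v mulmxA upN_mul mul0mx scaler0 addr0.
  rewrite -D0; apply: line_derive; exact: smooth_on_diff sh Ut.
by have := is_derive_0_is_cst (B a b) 0 dv; rewrite scale0r addr0.
Qed.

(** The linear form that acts as the field of [lowN Z]. *)
Definition linp (Z : 'M[R]_k) : P := \sum_c \sum_e Z c e *: var R c e.

Lemma act_linp Z p h y : smooth_on U h -> U y ->
  act (linp Z * p) h y = lfield (lowN Z) (act p h) y.
Proof.
move=> sh Uy; have sp : smooth_on U (act p h) by exact: smooth_on_act.
have lfD A C : lfield (A + C) (act p h) y =
    lfield A (act p h) y + lfield C (act p h) y.
  by rewrite -[A in LHS]scale1r lfieldP// mul1r.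
have lowND A C : lowN (A + C) = lowN A + lowN C :> V.
  by rewrite -[A in LHS]scale1r lowN_linear scale1r.
rewrite [in RHS](matrix_sum_delta Z) /linp mulr_suml act_sum.
pose G A := lfield (lowN A) (act p h) y.
have GD : {morph G : A C / A + C} by move=> A C; rewrite /G lowND lfD.
have G0 : G 0 = 0 by rewrite /G /lowN block_mx0 lfield0l.
have GZ t A : G (t *: A) = t * G A.
  have E : lowN (t *: A) = t *: lowN A + 0 :> V.
    by rewrite /lowN scale_block_mx !scaler0 addr0.
  by rewrite /G E (lfieldP _ _ _ sp Uy) lfield0l addr0.
rewrite -/(G _) (big_morph G GD G0); apply: eq_bigr => c _.
rewrite mulr_suml act_sum (big_morph G GD G0); apply: eq_bigr => e _.
by rewrite -scalerAl actZ act_var// GZ.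
Qed.

(** This serves both left multiplication by a Levi element, which mixes the variables linearly, and
    right translation, which fixes them. *)
Lemma act_comp (L : {linear V -> V}) (Z : 'I_k -> 'I_k -> 'M[R]_k) p h y :
  continuous L -> (forall z, U z -> U (L z)) ->
  (forall a b z, L (lowN (delta_mx a b) *m z) = lowN (Z a b) *m L z) ->
  smooth_on U h -> U y ->
  act p (h \o L) y = act (subst (\matrix_(a, b) linp (Z a b)) p) h (L y).
Proof.
move=> cL UL LZ sh; have sL : smooth_on U (h \o L).
  by move=> m; apply: class_C_subset UL (class_C_comp oU cL (sh m)).
elim/mpoly_ind1: p y => [||c p q IHp IHq|j p IH] y Uy.
- by rewrite rmorph0 !act0.
- by rewrite rmorph1 !act1.
- by rewrite linearP !act_lin IHp// IHq.
case/mxvec_indexP: j => a b; rewrite -/(var R a b) rmorphM /= subst_mxvec mxE.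
rewrite act_linp//; last exact: UL.
rewrite act_var//; set q := subst _ p.
transitivity (lfield (lowN (delta_mx a b)) ((act q h) \o L) y).
  by apply: eq_lfield => // z Uz; exact: IH.
by apply: lfield_comp => //; [exact: smooth_on_act|exact: UL].
Qed.

End integrated_equivariance.

(** * Equivariance of the image *)

(** This is the source character where det d = 1 + t and det g = 1 - t. The radicand has derivative
    -2k at 0, which the square root halves. *)
Lemma is_derive_half_modulus (R : realType) (i k : nat) : is_derive (0 : R) (1 : R)
  (fun t => (1 + t) ^+ i * Num.sqrt ((1 - t) ^+ k * (1 + t) ^- k)) (i%:R - k%:R).
Proof.
have dX n (c : R) : is_derive (0 : R) (1 : R) (fun t => (1 + c * t) ^+ n) (n%:R * c).
  rewrite (_ : (fun t => _) = horner ((1 + c *: 'X) ^+ n)); last first.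
    by apply/funext => t; rewrite !hornerE.
  apply: (is_derive_eq (is_derive_poly _ _)).
  rewrite deriv_exp derivD derivZ derivX derivC add0r hornerMn !hornerE.
  by rewrite expr1n mulr1 mulr_natl.
have dV : is_derive (0 : R) (1 : R) (fun t => (1 + 1 * t) ^- k) (- k%:R).
  pose q (t : R) : R := (1 + 1 * t) ^+ k.
  have d1 : is_derive (0 : R) (1 : R) q (k%:R * 1) := dX k 1.
  have q0 : q 0 = 1 by rewrite /q mulr0 addr0 expr1n.
  have n0 : q 0 != 0 by rewrite q0 oner_eq0.
  have dk : derivable q 0 1 := @ex_derive _ _ _ _ _ _ _ d1.
  have E := @deriveV _ _ q 0 1 n0 dk.
  rewrite (@derive_val _ _ _ _ _ _ _ d1) q0 expr1n invr1 scaleN1r mulr1 in E.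
  rewrite -E; exact: (DeriveDef (@derivableV _ _ q 0 1 n0 dk) erefl).
pose r (t : R) : R := (1 + -1 * t) ^+ k * (1 + 1 * t) ^- k.
have r0 : r 0 = 1 by rewrite /r !mulr0 addr0 !expr1n invr1 mulr1.
have dr : is_derive (0 : R) (1 : R) r (- (k%:R + k%:R)).
  apply: (is_derive_eq (is_deriveM (dX k (-1)) dV)).
  by rewrite !mulr0 addr0 !expr1n invr1 !scale1r mulrN1 opprD.
have ds : is_derive (0 : R) (1 : R) (Num.sqrt \o r) (- k%:R).
  have dq : is_derive (r 0) (1 : R) Num.sqrt (2 * Num.sqrt (r 0))^-1.
    by apply: is_derive1_sqrt; rewrite r0.
  apply: (is_derive_eq (is_derive1_comp dq dr)).
  by rewrite r0 sqrtr1; field.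
rewrite (_ : (fun t => _) = (fun t => (1 + 1 * t) ^+ i) * (Num.sqrt \o r)); last first.
  by apply/funext => t; rewrite /r fctE /= mulN1r mul1r.
apply: (is_derive_eq (is_deriveM (dX i 1) ds)).
by rewrite /= r0 sqrtr1 mulr0 addr0 expr1n !scale1r mulr1 addrC.
Qed.

Section induced_real.
Variables (R : realType) (k i : nat) (f : 'M[R]_(k + k) -> R).
Local Notation V := 'M[R]_(k + k).
Local Notation U := [set x : V | x \in unitmx].
Local Notation P := (mpoly (k * k) R).
Local Notation act := (act (@lowF R k)).
Implicit Types (y : V) (g d B : 'M[R]_k).

Definition half_modulus g d : R := Num.sqrt (`|\det g| ^+ k * `|\det d| ^- k).

Hypothesis sf : smooth_on U f.
Hypothesis ff : forall g d B y, g \in unitmx -> d \in unitmx -> U y ->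
  f (block_mx g B 0 d *m y) =
  \det d ^+ i * Num.sg (\det d) * half_modulus g d * f y.

Let oU : open U. Proof. exact: open_unitmx. Qed.

(** By linearity in row [a]; the matrix [A] has rows [a] and [b] equal when these indices differ,
    and is the identity otherwise. *)
Lemma det_add1_delta (t : R) (a b : 'I_k) :
  \det (1%:M + t *: delta_mx a b : 'M[R]_k) = 1 + t * (a == b)%:R.
Proof.
pose A : 'M[R]_k := \matrix_(c, e) if c == a then (b == e)%:R else (c == e)%:R.
rewrite (@determinant_multilinear _ _ _ 1%:M A a 1 t); first last.
- apply/matrixP => c e; rewrite !mxE [lift a c == a]eq_sym (negbTE (neq_lift a c)).
  by rewrite mulr0 addr0.
- apply/matrixP => c e; rewrite !mxE [lift a c == a]eq_sym (negbTE (neq_lift a c)).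
  by rewrite mulr0 addr0.
- by apply/rowP => e; rewrite !mxE eqxx mul1r [b == e]eq_sym.
rewrite det1 mul1r; congr (_ + _ * _).
have [ab|ab] := eqVneq a b.
  rewrite (_ : A = 1%:M) ?det1//; apply/matrixP => c e; rewrite !mxE -ab.
  by case: eqP => [->|].
apply: (determinant_alternate ab) => e.
by rewrite !mxE eqxx [b == a]eq_sym (negbTE ab).
Qed.

(** The formula is asked for small [t] only, since [induced_diag] needs 1 - t and 1 + t to stay
    positive. *)
Lemma lfield_of_line X y (t0 : R) (u : R -> R) (du : R) : U y -> 0 < t0 ->
  is_derive (0 : R) (1 : R) u du ->
  (forall t, `|t| < t0 -> f (y + t *: (X *m y)) = u t * f y) ->
  lfield X f y = du * f y.
Proof.
move=> Uy t00 du' E; rewrite lfieldE.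
have dl : is_derive (0 : R) (1 : R) (fun t : R => f (y + t *: (X *m y)))
    ('D_(X *m y) f (y + 0 *: (X *m y))).
  by apply: line_derive; rewrite scale0r addr0; exact: smooth_on_diff.
have := @derive_val _ _ _ _ _ _ _ dl; rewrite scale0r addr0 => <-.
rewrite (@near_eq_derive _ _ _ _ (fun t => u t * f y)); last first.
  by apply: filterS (nbhs0_lt t00) => t; exact: E.
have dc : is_derive (0 : R) (1 : R) (fun t => u t * f y) (du * f y).
  rewrite (_ : (fun t => _) = f y *: u); last first.
    by apply/funext => t; rewrite mulrC.
  by rewrite mulrC; exact: is_deriveZ.
exact: derive_val.
Qed.

Lemma induced_up a b y : U y -> lfield (upN (delta_mx a b)) f y = 0.
Proof.
move=> Uy; rewrite (@lfield_of_line _ _ 1 (cst 1) 0)// ?mul0r//.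
move=> t _; rewrite mul1r scalemxAl.
have -> : t *: upN (delta_mx a b) = upN (t *: delta_mx a b) :> V.
  by rewrite /upN scale_block_mx !scaler0.
rewrite upN_add1 ff ?unitmx1// !det1 sgr1 expr1n /half_modulus det1 normr1.
by rewrite expr1n invr1 !mulr1 sqrtr1 !mul1r.
Qed.

Lemma induced_diag a0 b0 a b y : U y ->
  lfield (diagN (- (delta_mx b0 a0 *m delta_mx a b)) (delta_mx a b *m delta_mx b0 a0)) f y =
  (i%:R - k%:R) * ((a0 == a) && (b0 == b))%:R * f y.
Proof.
move=> Uy; set e := (a0 == a) && (b0 == b).
have E t : `|t| < 1 -> f (y + t *: (diagN (- (delta_mx b0 a0 *m delta_mx a b))
    (delta_mx a b *m delta_mx b0 a0) *m y)) =
    ((1 + t * e%:R) ^+ i *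
     Num.sqrt ((1 - t * e%:R) ^+ k * (1 + t * e%:R) ^- k)) * f y.
  move=> t1; have [tm tp] : 0 < 1 - t * e%:R /\ 0 < 1 + t * e%:R.
    move: t1; rewrite ltr_norml => /andP[t1 t2].
    case: e; rewrite ?mulr1 ?mulr0 ?subr0 ?addr0 ?ltr01// subr_gt0 -ltrBlDl sub0r.
    by [].
  pose g : 'M[R]_k := 1%:M + (- t * (a0 == a)%:R) *: delta_mx b0 b.
  pose d : 'M[R]_k := 1%:M + (t * (b == b0)%:R) *: delta_mx a a0.
  have dg : \det g = 1 - t * e%:R.
    by rewrite det_add1_delta -mulrA -natrM mulnb mulNr.
  have dd : \det d = 1 + t * e%:R.
    rewrite det_add1_delta -mulrA -natrM mulnb /e; congr (1 + t * (_ : bool)%:R).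
    by rewrite andbC (eq_sym a) (eq_sym b).
  have ug : g \in unitmx by rewrite unitmxE dg unitfE gt_eqF.
  have ud : d \in unitmx by rewrite unitmxE dd unitfE gt_eqF.
  rewrite scalemxAl -{1}(mul1mx y) -mulmxDl.
  have -> : 1%:M + t *: diagN (- (delta_mx b0 a0 *m delta_mx a b))
      (delta_mx a b *m delta_mx b0 a0) = block_mx g 0 0 d.
    rewrite /diagN scale_block_mx scalar_mx_block add_block_mx !scaler0 !addr0.
    rewrite !mul_delta_mx_cond -!(mulr_natr (delta_mx _ _)).
    congr block_mx; rewrite /g /d.
      by case: (a0 == a); rewrite ?mulr0n ?mulr1n ?mulr0 ?mulr1 ?scale0r ?oppr0 ?scaler0 ?scalerN ?scaleNr.
    by case: (b == b0); rewrite ?mulr0n ?mulr1n ?mulr0 ?mulr1 ?scale0r ?scaler0.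
  by rewrite ff// /half_modulus dg dd gtr0_sg// mulr1 !gtr0_norm.
have [e1|e0] := boolP e.
  rewrite mulr1; apply: (lfield_of_line Uy ltr01 (is_derive_half_modulus R i k)) => t t1.
  by rewrite E// e1 mulr1.
rewrite mulr0; apply: (lfield_of_line (u := cst 1) Uy ltr01) => t t1.
by rewrite E// (negbTE e0) mulr0 subr0 addr0 !expr1n invr1 mulr1 sqrtr1 mul1r.
Qed.

Local Notation h := (act (detp R k ^+ i) f).

Lemma act_det_up B y : U y -> h (block_mx 1%:M B 0 1%:M *m y) = h y.
Proof.
move=> Uy; rewrite -upN_add1; apply: upN_invariant => //.
  exact: smooth_on_act.
move=> b0 a0 z Uz; apply: lfield_up_det => // [w Uw|a b w Uw].
  exact: induced_up.
exact: induced_diag.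
Qed.

(** Since [f (m z)] is a scalar multiple of [f z], the operator applied to z -> f(m z) can be
    computed in two ways: by this scalar, or by conjugating the fields through [m]. *)
Lemma act_det_levi g d y : g \in unitmx -> d \in unitmx -> U y ->
  h (block_mx g 0 0 d *m y) =
  \det g ^+ i * Num.sg (\det d) * half_modulus g d * h y.
Proof.
move=> ug ud Uy; pose m : V := block_mx g 0 0 d.
have um z : U z -> U (m *m z).
  by move=> Uz; rewrite /= unitmx_mul unitmxE det_ublock unitrM -!unitmxE ug ud.
pose Z a b : 'M[R]_k := d *m delta_mx a b *m invmx g.
have LZ a b (z : V) : mulmx m (lowN (delta_mx a b) *m z) = lowN (Z a b) *m mulmx m z.
  rewrite !mulmxA; congr (_ *m z); rewrite /m /lowN !mulmx_block.
  by rewrite !mul0mx !mulmx0 !addr0 !add0r /Z -mulmxA mulVmx// mulmx1.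
have := act_comp (detp R k ^+ i) (L := mulmx m) (@mulmx_continuous _ _ m) um LZ sf Uy.
rewrite rmorphXn /= subst_detp.
have -> : \det (\matrix_(a, b) linp (Z a b)) = (\det d / \det g) *: detp R k.
  (* The coefficient of [var R c e] in entry (a, b) is [d c a * invmx g b e], whence the
     transposes. *)
  have -> : \matrix_(a, b) linp (Z a b) = (map_mx (@mpolyC (k * k) R) d)^T *m
      (\matrix_(a, b) var R a b) *m (map_mx (@mpolyC (k * k) R) (invmx g))^T.
    apply/matrixP => a b; rewrite !mxE /linp exchange_big /=.
    apply: eq_bigr => e _; rewrite !mxE mulr_suml; apply: eq_bigr => c _.
    rewrite !mxE; set gi := invmx g.
    have -> : \sum_j (d *m delta_mx a b) c j * gi j e = d c a * gi b e.
      rewrite (bigD1 b)//= mxE (bigD1 a)//= mxE !eqxx mulr1 !big1 ?addr0// => l lb.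
        rewrite mxE big1 ?mul0r// => r _; by rewrite mxE (negbTE lb) andbF mulr0.
      by rewrite mxE (negbTE lb) mulr0.
    by rewrite -mul_mpolyC rmorphM /= mulrAC.
  rewrite !det_mulmx !det_tr !det_map_mx det_inv -/(detp R k).
  by rewrite mulrAC -rmorphM /= mul_mpolyC.
rewrite exprZn actZ => E.
have {E} : (\det d / \det g) ^+ i * h (m *m y) =
    (\det d ^+ i * Num.sg (\det d) * half_modulus g d) * h y.
  rewrite -E.
  rewrite -(actZr (@lowFC R k) _ _ sf Uy); apply: eq_act => // z Uz; exact: ff.
have dg : \det g != 0 by rewrite -unitfE -unitmxE.
have dd : \det d != 0 by rewrite -unitfE -unitmxE.
move=> E; apply: (@mulfI _ ((\det d / \det g) ^+ i)).
  by rewrite expf_neq0// mulf_neq0// invr_eq0.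
rewrite E expr_div_n; field.
by rewrite expf_neq0.
Qed.

(** An element of P is a unipotent element times a Levi element. *)
Lemma act_det_induced g d B y : g \in unitmx -> d \in unitmx -> U y ->
  h (block_mx g B 0 d *m y) =
  \det g ^+ i * Num.sg (\det d) * half_modulus g d * h y.
Proof.
move=> ug ud Uy.
have -> : block_mx g B 0 d *m y =
    block_mx 1%:M (B *m invmx d) 0 1%:M *m (block_mx g 0 0 d *m y).
  rewrite mulmxA; congr (_ *m y); rewrite mulmx_block.
  by rewrite !mul0mx !mulmx0 !mul1mx !addr0 !add0r -mulmxA mulVmx// mulmx1.
rewrite act_det_up ?act_det_levi//.
by rewrite /= unitmx_mul unitmxE det_ublock unitrM -!unitmxE ug ud.
Qed.

End induced_real.

(** * Differential operators and continuity *)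

Section differential_operators.
Variables (R : realType) (n : nat).
Local Notation V := 'M[R]_n.
Local Notation U := [set x : V | x \in unitmx].
Implicit Types (X v y : V) (f g h : V -> R) (vs ws : seq V).

Let oU : open U. Proof. exact: open_unitmx. Qed.

Definition derives vs h : V -> R := foldr (fun v g => 'D_v g) h vs.

Lemma eq_derives vs f g y : (forall x, U x -> f x = g x) -> U y ->
  derives vs f y = derives vs g y.
Proof.
by move=> fg; elim: vs y => [|v vs IH] y Uy /=; [exact: fg|exact: eq_derive_on].
Qed.

Definition coef := {a : V -> R | smooth_on U a}.
Implicit Types (s : seq (coef * seq V)).

(** Fields have variable direction, whereas jets use constant directions. This normal form, with
    smooth coefficients in front of constant-direction derivatives, connects the two. *)
Definition dop s h : V -> R :=
  fun y => \sum_(p <- s) sval p.1 y * derives p.2 h y.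

Definition coefD v (a : coef) : coef :=
  exist _ _ (smooth_on_derive v (svalP a)).

Definition coefM (a b : coef) : coef :=
  exist _ _ (smooth_onM oU (svalP a) (svalP b)).

Lemma dop_cat s1 s2 h y : dop (s1 ++ s2) h y = dop s1 h y + dop s2 h y.
Proof. by rewrite /dop big_cat. Qed.

Lemma dop_scale a s h y :
  dop [seq (coefM a p.1, p.2) | p <- s] h y = sval a y * dop s h y.
Proof.
by rewrite /dop big_map mulr_sumr; apply: eq_bigr => p _ /=; rewrite mulrA.
Qed.

Lemma derive_dop v s h y : smooth_on U h -> U y ->
  'D_v (dop s h) y =
  dop ([seq (coefD v p.1, p.2) | p <- s] ++ [seq (p.1, v :: p.2) | p <- s]) h y.
Proof.
move=> sh Uy; rewrite dop_cat /dop !big_map -big_split /=.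
have sp (p : coef * seq V) : smooth_on U (derives p.2 h) by exact: smooth_on_derives.
rewrite (derive_bigsum _ _ _).2 => [|p]; last first.
  by apply: smooth_on_diff Uy; apply: smooth_onM => //; exact: (svalP p.1).
by apply: eq_bigr => p _; rewrite deriveM_on//; exact: (svalP p.1).
Qed.

Definition is_dop (Q : (V -> R) -> V -> R) : Prop :=
  exists s, forall h, smooth_on U h -> forall y, U y -> Q h y = dop s h y.

Lemma is_dop_id : is_dop id.
Proof.
exists [:: (exist _ _ (smooth_on_cst U 1), [::])] => h sh y Uy.
by rewrite /dop big_seq1 /= mul1r.
Qed.

Lemma is_dop_derive v Q : is_dop Q -> is_dop (fun h => 'D_v (Q h)).
Proof.
move=> [s Qs].
exists ([seq (coefD v p.1, p.2) | p <- s] ++ [seq (p.1, v :: p.2) | p <- s]).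
move=> h sh y Uy; rewrite -derive_dop//.
by apply: eq_derive_on => // x Ux; exact: Qs.
Qed.

Lemma is_dop_derives vs Q : is_dop Q -> is_dop (fun h => derives vs (Q h)).
Proof. by move=> dQ; elim: vs => //= v vs; exact: is_dop_derive. Qed.

Lemma is_dopM (a : V -> R) Q : smooth_on U a -> is_dop Q ->
  is_dop (fun h y => a y * Q h y).
Proof.
move=> sa [s Qs]; pose c : coef := exist _ a sa.
by exists [seq (coefM c p.1, p.2) | p <- s] => h sh y Uy; rewrite Qs// dop_scale.
Qed.

Lemma is_dop_sum (I : Type) (r : seq I) (Q : I -> (V -> R) -> V -> R) :
  (forall i, is_dop (Q i)) -> is_dop (fun h y => \sum_(i <- r) Q i h y).
Proof.
move=> dQ; elim: r => [|i r [s IH]].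
  by exists [::] => h sh y Uy; rewrite /dop !big_nil.
have [si Qi] := dQ i; exists (si ++ s) => h sh y Uy.
by rewrite big_cons dop_cat Qi// IH.
Qed.

Lemma is_dop_ext Q1 Q2 :
  (forall h, smooth_on U h -> forall y, U y -> Q1 h y = Q2 h y) ->
  is_dop Q1 -> is_dop Q2.
Proof. by move=> Q12 [s Qs]; exists s => h sh y Uy; rewrite -Q12// Qs. Qed.

Lemma is_dop_lfield X Q : (forall h, smooth_on U h -> smooth_on U (Q h)) ->
  is_dop Q -> is_dop (fun h => lfield X (Q h)).
Proof.
move=> sQ dQ; apply: (@is_dop_ext
    (fun h y => \sum_i \sum_j lcoef X i j y * 'D_(delta_mx i j) (Q h) y)).
  by move=> h sh y Uy; rewrite lfield_coord//; exact: sQ.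
apply: is_dop_sum => i; apply: is_dop_sum => j; apply: is_dopM.
  exact: smooth_on_lcoef.
exact: is_dop_derive.
Qed.

Lemma is_dop_act N (F : 'I_N -> V) p : is_dop (act F p).
Proof.
apply: is_dop_sum => m; apply: is_dopM; first exact: smooth_on_cst.
elim: (m2s m) => [|j s IH]; first exact: is_dop_id.
by apply: is_dop_lfield => // h; exact: smooth_on_fields.
Qed.

(** The coefficients are continuous, hence bounded on the compact set [K]. *)
Lemma dop_bounded s (K : set (GL R n)) : compact K ->
  exists2 C, 0 <= C & forall h1 h2 (y : GL R n), K y ->
    `|dop s h1 y - dop s h2 y| <=
    C * \sum_(p <- s) `|derives p.2 h1 y - derives p.2 h2 y|.
Proof.
move=> cK.
have bd (a : coef) : exists2 C, 0 <= C & forall y : GL R n, K y -> `|sval a y| <= C.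
  have ca : continuous (fun y : GL R n => sval a y : R).
    move=> y; apply: continuous_comp; first exact: GLmx_continuous.
    by apply: smooth_on_continuous (svalP a) _; exact: GLmx_unit.
  have /compact_bounded[M [_ HM]] :
      compact ((fun y : GL R n => sval a y : R) @` K).
    by apply: continuous_compact => //; exact: continuous_subspaceT.
  exists (`|M| + 1); first by rewrite addr_ge0.
  move=> y Ky; apply: (HM (`|M| + 1)); last by exists y.
  by rewrite (le_lt_trans (ler_norm M))// ltrDl.
elim: s => [|p s [C C0 IH]].
  by exists 0 => // h1 h2 y _; rewrite /dop !big_nil subrr normr0 mul0r.
have [D D0 HD] := bd p.1; exists (C + D); first exact: addr_ge0.
move=> h1 h2 y Ky; rewrite /dop !big_cons opprD addrACA.
apply: le_trans (ler_normD _ _) _; rewrite mulrDr lerD//.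
  rewrite -mulrBr normrM ler_wpM2r// (le_trans (HD y Ky))// lerDr//.
apply: le_trans (IH h1 h2 y Ky) _; by rewrite ler_wpM2r ?lerDl// sumr_ge0.
Qed.

End differential_operators.

Local Open Scope complex_scope.

Lemma cvg_initial (S : choiceType) (T : topologicalType) (f : S -> T)
    (F : set_system S) (s : S) : Filter F ->
  f @ F --> f s -> F --> (s : initial_topology f).
Proof.
move=> FF c A /= [_ [[B oB <-] Bs] BA]; rewrite nbhs_filterE.
by apply: filterS BA _; apply: c; exact: open_nbhs_nbhs.
Qed.

(** * The topology of the induced representation *)

Section ind_topology.
Variables (R : realType) (k : nat) (chi1 chi2 : character R k).
Local Notation I := (ind chi1 chi2).
Local Notation G := (GL R (k + k)).
Local Notation W := {family compact, G -> R[i]^o}.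
Implicit Types (vs : seq 'M[R]_(k + k)) (K : set G).

Lemma jet_near (f0 : I) vs K (e : R) : compact K -> 0 < e ->
  \forall f \near f0, forall y, K y -> `|jet f0 vs y - jet (f : I) vs y| < e%:C.
Proof.
move=> cK e0.
have c1 : continuous (fun f : I => @jet R (k + k) f : {ptws seq 'M[R]_(k + k) -> W}).
  exact: initial_continuous.
have c2 : continuous (fun F : {ptws seq 'M[R]_(k + k) -> W} => F vs).
  exact: proj_continuous.
have c : (fun f : I => jet f vs : W) @ f0 --> (jet f0 vs : W).
  exact: (continuous_comp (c1 f0) (c2 _)).
have /fam_cvgP/(_ K cK) cu := c.
have := cu _ [set h : G -> R[i]^o | forall y, K y -> `|jet f0 vs y - h y| < e%:C].
rewrite nbhs_simpl; apply; first exact: (@fmap_filter _ _ _ _ (nbhs_filter f0)).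
apply/uniform_nbhs; exists [set xy : R[i]^o * R[i]^o | `|xy.1 - xy.2| < e%:C].
by split => //=; rewrite -entourage_ballE; exists e%:C => //=; rewrite ltcR.
Qed.

Lemma ind_cvg (F : set_system I) (f0 : I) : Filter F ->
  (forall vs K (e : R), compact K -> 0 < e ->
     \forall f \near F, forall y, K y -> `|jet f0 vs y - jet (f : I) vs y| < e%:C) ->
  F --> f0.
Proof.
move=> FF H; apply: cvg_initial; apply/cvg_sup => vs; apply: cvg_initial.
apply/fam_cvgP => K cK A /uniform_nbhs[E [entE EA]].
move: entE; rewrite -entourage_ballE => -[e /= e0 Ee].
(* A positive element of [R[i]] is real. *)
have eE : e = (complex.Re e)%:C.
  by case: e e0 {Ee} => a b; rewrite ltcE /= => /andP[/eqP-> _].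
have re0 : 0 < complex.Re e by move: e0; rewrite eE ltcR.
rewrite nbhs_simpl; apply: filterS (H vs K _ cK re0) => f Hf.
apply: EA => y Ky; apply: Ee => /=.
by rewrite -ball_normE /= eE; exact: Hf.
Qed.

End ind_topology.

(** * Real and imaginary parts *)

Section real_parts.
Variables (R : realType) (n : nat).
Implicit Types (f : GL R n -> R[i]) (vs : seq 'M[R]_n) (y : 'M[R]_n).

Definition re f : 'M[R]_n -> R := fun y => complex.Re (ext f y).
Definition im f : 'M[R]_n -> R := fun y => complex.Im (ext f y).

Lemma smooth_reim f : smooth f <->
  smooth_on [set x | x \in unitmx] (re f) /\ smooth_on [set x | x \in unitmx] (im f).
Proof. by split=> [sf|[sr si] m]; split=> // m; have [] := sf m. Qed.

Lemma Re_jet f vs (y : GL R n) : complex.Re (jet f vs y) = derives vs (re f) y.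
Proof.
rewrite /jet; suff -> : derives vs (re f) = fun x => complex.Re (foldr (@dirderiv R n) (ext f) vs x).
  by [].
by elim: vs => //= v vs ->.
Qed.

Lemma Im_jet f vs (y : GL R n) : complex.Im (jet f vs y) = derives vs (im f) y.
Proof.
rewrite /jet; suff -> : derives vs (im f) = fun x => complex.Im (foldr (@dirderiv R n) (ext f) vs x).
  by [].
by elim: vs => //= v vs ->.
Qed.

Lemma normci : `|'i%C : R[i]| = 1.
Proof. by rewrite normc_def /= expr0n expr1n add0r sqrtr1. Qed.

Lemma Im_normc (z : R[i]) : `|complex.Im z|%:C <= `|z|.
Proof.
have := normc_ge_Re (z * 'i%C); rewrite normrM normci mulr1.
by case: z => a b /=; rewrite mulr0 mulr1 sub0r normrN.
Qed.

Lemma normc_le_ReIm (z : R[i]) : `|z| <= (`|complex.Re z| + `|complex.Im z|)%:C.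
Proof.
rewrite [in leLHS](complexE z) (le_trans (ler_normD _ _))// normrM normci mul1r.
by rewrite !normc_def /= !expr0n /= !addr0 !sqrtr_sqr -rmorphD.
Qed.

End real_parts.

(** * Real polynomials in the lower fields on complex-valued functions *)

Section polynomial_operator.
Variables (R : realType) (k : nat) (p : mpoly (k * k) R).
Local Notation V := 'M[R]_(k + k).
Local Notation U := [set x : V | x \in unitmx].
Local Notation G := (GL R (k + k)).
Implicit Types (f g : G -> R[i]).

Let oU : open U. Proof. exact: open_unitmx. Qed.

Definition cact f : G -> R[i] :=
  fun y => (act (@lowF R k) p (re f) y) +i* (act (@lowF R k) p (im f) y).

Lemma re_cact f y : U y -> re (cact f) y = act (@lowF R k) p (re f) y.
Proof. by move=> Uy; rewrite /re -[y]/(GLmx (MkGL Uy)) extE. Qed.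

Lemma im_cact f y : U y -> im (cact f) y = act (@lowF R k) p (im f) y.
Proof. by move=> Uy; rewrite /im -[y]/(GLmx (MkGL Uy)) extE. Qed.

Lemma smooth_cact f : smooth f -> smooth (cact f).
Proof.
move=> /smooth_reim[sr si]; apply/smooth_reim; split.
- apply: eq_smooth_on oU _ _ _ (smooth_on_act _ _ sr) => y Uy.
  by rewrite re_cact.
- apply: eq_smooth_on oU _ _ _ (smooth_on_act _ _ si) => y Uy.
  by rewrite im_cact.
Qed.

(** Every seminorm of the image is controlled by finitely many seminorms of the argument, on the
    same compact set; this is what continuity rests on. *)
Lemma jet_cact_bounded ws (K : set G) : compact K ->
  exists C (S : seq (seq V)), 0 <= C /\ forall f g, smooth f -> smooth g ->
    forall y, K y -> `|jet (cact f) ws y - jet (cact g) ws y| <=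
      C%:C * \sum_(vs <- S) `|jet f vs y - jet g vs y|.
Proof.
move=> cK.
have [s Hs] := is_dop_derives ws (is_dop_act (@lowF R k) p).
have [C C0 HC] := dop_bounded s cK.
(* One [C] pays for the real part, the other for the imaginary part. *)
exists (C + C), (unzip2 s); split; first exact: addr_ge0.
move=> f g /smooth_reim[fr fi] /smooth_reim[gr gi] y Ky.
have Uy : U (y : V) := GLmx_unit y.
have E h : smooth h -> (derives ws (re (cact h)) y = dop s (re h) y) *
    (derives ws (im (cact h)) y = dop s (im h) y).
  move=> /smooth_reim[hr hi]; rewrite -!Hs//; split; apply: eq_derives => // z Uz.
  - exact: re_cact.
  - exact: im_cact.
have sum_le (F : seq V -> R) : (forall vs, (F vs)%:C <= `|jet f vs y - jet g vs y|) ->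
    (\sum_(q <- s) F q.2)%:C <= \sum_(vs <- unzip2 s) `|jet f vs y - jet g vs y|.
  by move=> HF; rewrite big_map rmorph_sum; apply: ler_sum => q _; exact: HF.
apply: le_trans (normc_le_ReIm _) _; rewrite !raddfB /= !Re_jet !Im_jet.
have sf : smooth f by apply/smooth_reim.
have sg : smooth g by apply/smooth_reim.
rewrite !E// rmorphD rmorphD mulrDl lerD//.
  apply: (@le_trans _ _ (C * \sum_(q <- s) `|derives q.2 (re f) y - derives q.2 (re g) y|)%:C).
    by rewrite lecR; exact: HC.
  rewrite rmorphM ler_wpM2l ?lecR//; apply: (sum_le (fun vs => `|derives vs (re f) y - derives vs (re g) y|)) => vs.
  by rewrite -!Re_jet -raddfB; exact: normc_ge_Re.
apply: (@le_trans _ _ (C * \sum_(q <- s) `|derives q.2 (im f) y - derives q.2 (im g) y|)%:C).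
  by rewrite lecR; exact: HC.
rewrite rmorphM ler_wpM2l ?lecR//; apply: (sum_le (fun vs => `|derives vs (im f) y - derives vs (im g) y|)) => vs.
by rewrite -!Im_jet -raddfB; exact: Im_normc.
Qed.

Lemma cact_continuous (chi1 chi2 psi1 psi2 : character R k)
    (T : ind chi1 chi2 -> ind psi1 psi2) :
  (forall f : ind chi1 chi2, indfun (T f) = cact f) -> continuous T.
Proof.
move=> TE f0; have FN : Filter (nbhs f0) := nbhs_filter f0.
have FF := @fmap_filter _ _ T _ FN.
apply: (ind_cvg FF) => ws K e cK e0; rewrite near_simpl.
have sm (f : ind chi1 chi2) : smooth f by have /asboolP[] := indfunP f.
have [C [S [C0 H]]] := jet_cact_bounded ws cK.
(* The added units keep the divisor positive when [C = 0] or [S] is empty, and make the final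
   estimate strict. *)
pose e' := e / ((C + 1) * (size S).+1%:R).
have C1 : 0 < C + 1 by rewrite ltr_wpDl.
have d0 : 0 < (C + 1) * (size S).+1%:R by rewrite mulr_gt0// ltr0n.
have e'0 : 0 < e' by rewrite divr_gt0.
have N : \forall f \near f0, forall vs, vs \in S -> forall y, K y ->
    `|jet f0 vs y - jet (f : ind chi1 chi2) vs y| < e'%:C.
  elim: (S) => [|vs s IH]; first exact: (@filterS _ _ FN setT _ _ (@filterT _ _ FN)).
  have := @filterI _ _ FN _ _ IH (jet_near f0 vs cK e'0).
  apply: (@filterS _ _ FN) => f [Hs Hvs] ws'.
  by rewrite in_cons => /orP[/eqP->|/Hs].
apply: (@filterS _ _ FN) N => f Hf y Ky; rewrite !TE.
apply: le_lt_trans (H _ _ (sm f0) (sm f) y Ky) _.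
apply: (@le_lt_trans _ _ (C * ((size S)%:R * e'))%:C).
  rewrite rmorphM /= ler_wpM2l ?lecR//.
  have -> : ((size S)%:R * e')%:C = \sum_(vs <- S) e'%:C :> R[i].
    rewrite -(rmorph_sum (real_complex R)) big_const_seq count_predT iter_addr addr0.
    by rewrite mulr_natl.
  rewrite big_seq [leRHS]big_seq; apply: ler_sum => vs vsS.
  exact/ltW/Hf.
rewrite ltcR mulrA (lt_le_trans (y := (C + 1) * (size S).+1%:R * e'))//.
  rewrite ltr_pM2r// -natr1 mulrDr mulr1 ltr_pwDr//.
  by rewrite ler_wpM2r ?lerDl.
by rewrite /e' mulrC divfK// gt_eqF.
Qed.

End polynomial_operator.

(** * A test function *)

Section test_function.
Variables (R : realType) (k : nat).
Local Notation V := 'M[R]_(k + k).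
Local Notation U := [set x : V | x \in unitmx].
Local Notation P := (mpoly (k * k) R).
Implicit Types (y : V) (rho : V -> R) (q : P) (s : seq 'I_(k * k)).

Let oU : open U. Proof. exact: open_unitmx. Qed.

Definition low_eval q : V -> R := fun y => meval (fun j => mxvec (dlsubmx y) 0 j) q.

Lemma low_eval_var a b q y :
  low_eval (var R a b * q) y = y (rshift k a) (lshift k b) * low_eval q y.
Proof. by rewrite /low_eval mevalM mevalXU mxvecE !mxE. Qed.

Lemma smooth_on_low_eval q : smooth_on U (low_eval q).
Proof.
elim/mpoly_ind1: q => [||c p q IHp IHq|j q IH].
- by apply: eq_smooth_on (smooth_on_cst U 0) => // y _; rewrite /low_eval meval0.
- by apply: eq_smooth_on (smooth_on_cst U 1) => // y _; rewrite /low_eval meval1.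
- have sc : smooth_on U (fun=> c) by exact: smooth_on_cst.
  apply: eq_smooth_on (smooth_onD oU (smooth_onM oU sc IHp) IHq) => // y _.
  by rewrite /low_eval mevalD mevalZ.
case/mxvec_indexP: j => a b.
have sc := @smooth_on_coord R (k + k) (rshift k a) (lshift k b).
apply: eq_smooth_on (smooth_onM oU sc IH) => // y _.
by rewrite -/(var R a b) low_eval_var.
Qed.

Lemma low_eval1 q : low_eval q 1%:M = mcoeff mnm0 q.
Proof.
have z : dlsubmx (1%:M : V) = 0 by rewrite scalar_mx_block block_mxKdl.
elim/mpoly_ind1: q => [||c p q IHp IHq|j q IH].
- by rewrite /low_eval meval0 mcoeff0.
- by rewrite /low_eval meval1 mcoeff1 eqxx.
- by rewrite mcoeffD mcoeffZ -IHp -IHq /low_eval mevalD mevalZ.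
rewrite /low_eval mevalM mevalXU z linear0 mxE mul0r; apply/esym.
apply: memN_msupp_eq0; apply/negP.
rewrite mulrC (perm_mem (msuppMX _ _)) => /mapP[m _ /mnmP/(_ j)].
by rewrite mnm0E mnmDE mnm1E eqxx.
Qed.

Lemma derive_coord_fun (i j : 'I_(k + k)) v y : 'D_v (fun z : V => z i j) y = v i j.
Proof.
rewrite (_ : (fun z : V => z i j) = lcoef 1%:M i j); last first.
  by apply/funext => z; rewrite /lcoef mul1mx.
transitivity (lcoef 1%:M i j v); last by rewrite /lcoef mul1mx.
by apply: derive_linear; exact: lcoef_continuous.
Qed.

(** The lower left block of [lowN Z *m y] is [Z] times the upper left block of [y], so the field
    differentiates [q] with coefficients from that block, which is the identity at [1]. *)
Lemma lfield_low_eval a b q y : U y -> lfield (lowN (delta_mx a b)) (low_eval q) y =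
  \sum_e y (lshift k b) (lshift k e) * low_eval (partial a e q) y.
Proof.
have lowE c e z : (lowN (delta_mx a b) *m z : V) (rshift k c) (lshift k e) =
    (c == a)%:R * z (lshift k b) (lshift k e).
  rewrite -[z]submxK /lowN mulmx_block !mul0mx !addr0 block_mxEdl block_mxEul.
  rewrite mxE (bigD1 b)//= big1 ?addr0 ?mxE ?eqxx ?andbT// => l lb.
  by rewrite mxE (negbTE lb) andbF mul0r.
elim/mpoly_ind1: q y => [||c p q IHp IHq|j q IH] y Uy.
- rewrite big1 => [|e _]; last by rewrite linear0 /low_eval meval0 mulr0.
  rewrite -(lfield0 (lowN (delta_mx a b)) y); apply: eq_lfield => // z _.
  by rewrite /low_eval meval0.
- rewrite big1 => [|e _]; last first.
    by rewrite -[1]mpolyX0 /partial mderivX mnm0E scale0r /low_eval meval0 mulr0.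
  rewrite lfieldE -(derive_cst (1 : R) y (lowN (delta_mx a b) *m y)).
  by apply: eq_derive_on => // z _; rewrite /low_eval meval1.
- have sp := smooth_on_low_eval p; have sq := smooth_on_low_eval q.
  transitivity (lfield (lowN (delta_mx a b)) (fun z => c * low_eval p z + low_eval q z) y).
    by apply: eq_lfield => // z _; rewrite /low_eval mevalD mevalZ.
  rewrite lfield_lin// IHp// IHq// mulr_sumr -big_split; apply: eq_bigr => e _ /=.
  by rewrite linearP /low_eval mevalD mevalZ mulrDr mulrCA.
case/mxvec_indexP: j => c e; rewrite -/(var R c e).
have sq := smooth_on_low_eval q.
transitivity (lfield (lowN (delta_mx a b))
    (fun z => z (rshift k c) (lshift k e) * low_eval q z) y).
  by apply: eq_lfield => // z _; rewrite low_eval_var.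
rewrite lfieldE (deriveM_on _ (smooth_on_coord R _ _) sq Uy) derive_coord_fun lowE.
rewrite -lfieldE IH//.
under [RHS]eq_bigr => l _.
  rewrite partialM partial_var /low_eval mevalD -/(low_eval _ y) -/(low_eval _ y).
  rewrite low_eval_var mulrDr; over.
rewrite big_split /=; congr (_ + _).
  rewrite (bigD1 e)//= big1 ?addr0 => [|l le].
    rewrite eqxx andbT (eq_sym a); case: (c == a); rewrite ?mul1r// !mul0r.
    by rewrite /low_eval meval0 mulr0.
  by rewrite (negbTE le) andbF mul0r /low_eval meval0 mulr0.
by rewrite mulr_sumr; apply: eq_bigr => l _; rewrite mulrCA.
Qed.

Local Notation fields := (fields (@lowF R k)).

Lemma fields_rcons s j h : fields (rcons s j) h = fields s (lfield (lowF R j) h).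
Proof. exact: foldr_rcons. Qed.

Lemma fields_sum (I : Type) (r : seq I) (F : I -> V -> R) s y :
  (forall i, smooth_on U (F i)) -> U y ->
  fields s (fun z => \sum_(i <- r) F i z) y = \sum_(i <- r) fields s (F i) y.
Proof.
move=> sF; elim: s y => // j s IH y Uy /=.
transitivity (lfield (lowF R j) (fun z => \sum_(i <- r) fields s (F i) z) y).
  exact: eq_lfield.
rewrite lfieldE (derive_bigsum _ _ _).2// => i.
by apply: smooth_on_diff Uy; exact: smooth_on_fields.
Qed.

Lemma eq_fields s f g y : (forall x, U x -> f x = g x) -> U y ->
  fields s f y = fields s g y.
Proof.
by move=> fg; elim: s y => [|j s IH] y Uy /=; [exact: fg|exact: eq_lfield].
Qed.

Lemma fieldsD s f g y : smooth_on U f -> smooth_on U g -> U y ->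
  fields s (fun z => f z + g z) y = fields s f y + fields s g y.
Proof.
move=> sf sg; elim: s y => // j s IH y Uy /=.
have H := lfield_lin (lowF R j) 1 (smooth_on_fields (@lowF R k) s sf)
  (smooth_on_fields (@lowF R k) s sg) Uy.
rewrite mul1r in H; rewrite -H; apply: eq_lfield => // z Uz.
by rewrite mul1r IH.
Qed.

Lemma foldr_mderiv_low s q :
  (forall m, (mdeg m <= size s)%N -> mcoeff m q = 0) ->
  mcoeff mnm0 (foldr (@mderiv _ R) q s) = 0.
Proof.
elim/last_ind: s q => [|s j IH] q q0; first by rewrite q0 ?mdeg0.
rewrite foldr_rcons IH// => m ms.
by rewrite mcoeff_deriv q0 ?mul0rn// mdegD mdeg1 addn1 size_rcons.
Qed.

(* The lower left block vanishes at [1], so only the part of [q] of degree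
   exactly [size s] contributes. *)
Lemma fields_low_eval s q rho : smooth_on U rho ->
  (forall m, (mdeg m < size s)%N -> mcoeff m q = 0) ->
  fields s (fun y => low_eval q y * rho y) 1%:M =
  mcoeff mnm0 (foldr (@mderiv _ R) q s) * rho 1%:M.
Proof.
have U1 : U 1%:M by exact: unitmx1.
elim/last_ind: s q rho => [|s j IH] q rho srho q0; first by rewrite /= low_eval1.
case/mxvec_indexP: j q0 => a b q0; rewrite size_rcons in q0.
have sq p : smooth_on U (low_eval p) by exact: smooth_on_low_eval.
pose ye e (y : V) := y (lshift k b) (lshift k e).
have sy e : smooth_on U (fun y => ye e y * rho y).
  by apply: smooth_onM => //; exact: smooth_on_coord.
pose D := lowN (delta_mx a b) : V.
have sD : smooth_on U (lfield D rho) by exact: smooth_on_lfield.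
have E y : U y -> lfield D (fun y => low_eval q y * rho y) y =
    \sum_e low_eval (partial a e q) y * (ye e y * rho y) + low_eval q y * lfield D rho y.
  move=> Uy; rewrite lfieldE (deriveM_on _ (sq q) srho Uy) -!lfieldE lfield_low_eval//.
  congr (_ + _); rewrite mulr_suml; apply: eq_bigr => e _.
  by rewrite mulrCA !mulrA.
rewrite foldr_rcons [LHS](_ : _ = fields s (fun y =>
    \sum_e low_eval (partial a e q) y * (ye e y * rho y) +
    low_eval q y * lfield D rho y) 1%:M); last first.
  by rewrite fields_rcons lowF_index; exact: eq_fields.
have cq e m : (mdeg m < size s)%N -> mcoeff m (partial a e q) = 0.
  by move=> ms; rewrite /partial mcoeff_deriv q0 ?mul0rn// mdegD mdeg1 addn1 ltnS.
rewrite fieldsD//; last first.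
- by apply: smooth_onM.
- by apply: smooth_on_sum => // e; exact: smooth_onM.
rewrite fields_sum//; last by move=> e; exact: smooth_onM.
(* If the field falls on [rho], one derivative too few is left for [q], and the term vanishes at
   [1]. *)
rewrite [X in _ + X]IH//; last by move=> m ms; rewrite q0// ltnS ltnW.
rewrite foldr_mderiv_low ?mul0r ?addr0; last by move=> m ms; rewrite q0.
(* At [1] the coefficient [ye e] is 1 for [e = b] and 0 otherwise. *)
rewrite (bigD1 b)//= IH//; last exact: cq.
rewrite big1 => [|e eb].
  by rewrite addr0 /ye mxE eqxx mul1r.
rewrite IH//; last exact: cq.
by rewrite /ye mxE (inj_eq (@lshift_inj _ _)) eq_sym (negbTE eb) mul0r mulr0.
Qed.

(** Up to the factor [rho 1%:M], the value is the Fischer inner product of [p] with itself, where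
    each variable is paired with its own derivative. *)
Lemma act_low_eval_gt0 p d rho : p \is ishomog1 d mdeg -> p != 0 ->
  smooth_on U rho -> 0 < rho 1%:M ->
  0 < act (@lowF R k) p (fun y => low_eval p y * rho y) 1%:M.
Proof.
move=> /dhomogP hp p0 srho r0.
have E m : m \in msupp p ->
    mcoeff m p * fields (m2s m) (fun y => low_eval p y * rho y) 1%:M =
    mcoeff m p ^+ 2 * (\prod_i (m i)`!)%:R * rho 1%:M.
  move=> mp; rewrite fields_low_eval//.
    have m0 : mnm_add m mnm0 = m by apply/mnmP => j; rewrite mnmDE mnm0E addn0.
    rewrite -mderivm_foldr mcoeff_mderivm m0 expr2 -[mcoeff m p *+ _]mulr_natr !mulrA.
    by congr (_ * _%:R * _); apply: eq_bigr => j _; rewrite ffactnn.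
  (* Homogeneity: a monomial of lower degree than [m] does not occur in [p]. *)
  move=> m'; rewrite size_m2s (hp m mp) => m'd; apply: memN_msupp_eq0.
  by apply/negP => /hp m'E; rewrite m'E ltnn in m'd.
rewrite /act big_seq (eq_bigr _ E) -big_seq.
(* All summands are nonnegative, and the one of the leading monomial is positive. *)
rewrite (bigD1_seq _ (mlead_supp p0)) ?msupp_uniq//=.
have F (m : multinom (k * k)) : 0 < (\prod_i (m i)`!)%:R :> R.
  by rewrite ltr0n prodn_gt0// => j; exact: fact_gt0.
have lp : 0 < mcoeff (mlead p) p ^+ 2.
  by rewrite lt0r sqr_ge0 expf_neq0// -mcoeff_msupp mlead_supp.
rewrite ltr_pwDl//; first by rewrite mulr_gt0// mulr_gt0.
apply: sumr_ge0 => m _; apply: mulr_ge0; last exact: ltW.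
by apply: mulr_ge0; [exact: sqr_ge0|exact: ltW].
Qed.

(** The Gram determinant of the rows of [C]; a left factor [d] multiplies it by (det d)^2. *)
Definition det_pair (C : 'M[R]_(k, k + k)) : R := \det (C *m C^T).

(** A vector in the kernel of the Gram matrix gives a combination of the lower rows of [y] of length
    zero, and the rows of an invertible matrix are independent. *)
Lemma det_pair_neq0 y : U y -> det_pair (dsubmx y) != 0.
Proof.
move=> Uy; apply/negP => /eqP/eqP/det0P[v v0 vC].
have : (v *m dsubmx y) *m (v *m dsubmx y)^T = 0.
  by rewrite trmx_mul mulmxA -(mulmxA v) vC mul0mx.
move=> /matrixP/(_ 0 0); rewrite !mxE => /eqP.
under eq_bigr do rewrite [_^T _ _]mxE -expr2.
rewrite psumr_eq0 => [/allP H|j _]; last exact: sqr_ge0.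
have w0 : v *m dsubmx y = 0.
  apply/rowP => j; rewrite [RHS]mxE; apply/eqP.
  by have := H j (mem_index_enum _); rewrite /= sqrf_eq0.
move: v0; have : row_mx 0 v *m y = 0 :> 'rV[R]_(k + k).
  by rewrite -[y]vsubmxK mul_row_col mul0mx add0r.
move/(canRL (mulmxK Uy)); rewrite mul0mx -[0 in RHS]row_mx0 => /eq_row_mx[_ ->].
by rewrite eqxx.
Qed.

(* On bottom blocks (c d), up to a power of the determinant, this is
   det(c)^i det(d) det(cc^T + dd^T)^(-(k+1)/2). *)
Definition test_rho y : R := \det (drsubmx y) *
  Num.sqrt (Num.sqrt (\det y ^+ 2) ^+ k *
    (Num.sqrt (det_pair (dsubmx y) ^+ 2) ^+ k.+1)^-1).

Definition test_fun (i : nat) y : R := low_eval (detp R k ^+ i) y * test_rho y.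

Lemma low_eval_det i y : low_eval (detp R k ^+ i) y = \det (dlsubmx y) ^+ i.
Proof.
rewrite /low_eval rmorphXn /= meval_detp; congr (\det _ ^+ i).
by apply/matrixP => a b; rewrite mxE mxvecE.
Qed.

Lemma smooth_on_det m (M : V -> 'M[R]_m) :
  (forall a b, smooth_on U (fun y => M y a b)) -> smooth_on U (fun y => \det (M y)).
Proof.
move=> sM; apply: smooth_on_sum => // s; apply: smooth_onM => //.
  exact: smooth_on_cst.
by apply: smooth_on_prod.
Qed.

(** The absolute values are written as [Num.sqrt (_ ^+ 2)] and taken only of quantities that never
    vanish on [U]; the lower right determinant, which may vanish, enters polynomially. *)
Lemma smooth_on_test_rho : smooth_on U test_rho.
Proof.
have sc a b : smooth_on U (fun y : V => y a b) by exact: smooth_on_coord.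
have sdet : smooth_on U (fun y : V => \det y) by apply: smooth_on_det.
have spair : smooth_on U (fun y => det_pair (dsubmx y)).
  apply: smooth_on_det => a b.
  apply: eq_smooth_on (_ : smooth_on U (fun y : V =>
    \sum_j y (rshift k a) j * y (rshift k b) j)) => // [y _|].
    by rewrite mxE; apply: eq_bigr => j _; rewrite !mxE.
  by apply: smooth_on_sum => // j; exact: smooth_onM.
have dy y : U y -> \det y != 0 by rewrite /= unitmxE unitfE.
have p1 y : U y -> 0 < \det y ^+ 2 by move=> /dy d0; rewrite lt0r expf_neq0// sqr_ge0.
have p2 y : U y -> 0 < det_pair (dsubmx y) ^+ 2.
  by move=> /det_pair_neq0 d0; rewrite lt0r expf_neq0// sqr_ge0.
have s1 : smooth_on U (fun y : V => Num.sqrt (\det y ^+ 2)).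
  by apply: smooth_on_sqrt => //; exact: smooth_onX.
have s2 : smooth_on U (fun y : V => Num.sqrt (det_pair (dsubmx y) ^+ 2)).
  by apply: smooth_on_sqrt => //; exact: smooth_onX.
have q1 y : U y -> 0 < Num.sqrt (\det y ^+ 2) by move=> /p1; rewrite sqrtr_gt0.
have q2 y : U y -> 0 < Num.sqrt (det_pair (dsubmx y) ^+ 2).
  by move=> /p2; rewrite sqrtr_gt0.
apply: smooth_onM => //.
  by apply: smooth_on_det => a b; apply: eq_smooth_on (sc (rshift k a) (rshift k b)) => // y _; rewrite !mxE.
apply: smooth_on_sqrt => // [y Uy|].
  by rewrite mulr_gt0 ?invr_gt0 ?exprn_gt0 ?q1 ?q2.
apply: smooth_onM => //; first exact: smooth_onX.
apply: smooth_onV => //; last exact: smooth_onX.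
by move=> y Uy; rewrite expf_neq0// gt_eqF// q2.
Qed.

Lemma smooth_on_test_fun i : smooth_on U (test_fun i).
Proof.
by apply: smooth_onM => //; [exact: smooth_on_low_eval|exact: smooth_on_test_rho].
Qed.

(** The powers of |det d| are k/2 from det y, -(k+1) from the Gram determinant and 1 from the lower
    right determinant; they add up to -k/2. The latter determinant also gives the sign. *)
Lemma test_fun_induced i g d B y : g \in unitmx -> d \in unitmx -> U y ->
  test_fun i (block_mx g B 0 d *m y) =
  \det d ^+ i * Num.sg (\det d) * half_modulus g d * test_fun i y.
Proof.
move=> ug ud Uy; have dd : \det d != 0 by rewrite -unitfE -unitmxE.
have dE : dsubmx (block_mx g B 0 d *m y) = d *m dsubmx y.
  by rewrite -[y in LHS]vsubmxK mul_block_col col_mxKd mul0mx add0r.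
rewrite /test_fun /test_rho !low_eval_det det_mulmx det_ublock.
rewrite /drsubmx /dlsubmx !dE /det_pair trmx_mul mulmxA -(mulmxA d) !det_mulmx det_tr.
rewrite -!mulmx_rsub -!mulmx_lsub !det_mulmx !sqrtr_sqr /half_modulus.
have := det_pair_neq0 Uy; rewrite /det_pair.
move: (\det (dsubmx y *m _)) (\det y) (\det g) => q e c q0.
have nd : `|\det d| != 0 by rewrite normr_eq0.
have nq : `|q| != 0 by rewrite normr_eq0.
(* Besides the modulus, the radicand contains |det d|^(-2); its root turns the factor det d into its
   sign. *)
have -> : `|c * \det d * e| ^+ k / `|\det d * q * \det d| ^+ k.+1 =
    `|c| ^+ k * `|\det d| ^- k *
    (`|\det d|^-1 ^+ 2 * (`|e| ^+ k / `|q| ^+ k.+1)).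
  by rewrite !normrM !exprMn !exprS; field; rewrite !expf_neq0 ?nd ?nq.
rewrite sqrtrM; last by rewrite mulr_ge0 ?invr_ge0 ?exprn_ge0.
rewrite (@sqrtrM _ (`|\det d|^-1 ^+ 2) _ (sqr_ge0 _)) sqrtr_sqr normfV normr_id exprMn.
have -> : Num.sg (\det d) = \det d / `|\det d|.
  by rewrite {2}[\det d]numEsg mulfK.
move: `|_|^-1 (Num.sqrt _) (Num.sqrt _) => u v w; ring.
Qed.

Lemma act_test_fun_neq0 i : act (@lowF R k) (detp R k ^+ i) (test_fun i) 1%:M != 0.
Proof.
rewrite gt_eqF//; apply: (@act_low_eval_gt0 _ (k * i)%N).
- by apply: dhomogMn; exact: detp_homog.
- by rewrite expf_neq0// detp_neq0.
- exact: smooth_on_test_rho.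
have E : dsubmx (1%:M : V) = row_mx 0 1%:M by rewrite scalar_mx_block /block_mx col_mxKd.
rewrite /test_rho /drsubmx E row_mxKr /det_pair tr_row_mx mul_row_col.
by rewrite trmx1 mulmx1 mul0mx add0r !det1 !expr1n sqrtr1 !expr1n invr1 !mulr1 sqrtr1.
Qed.

End test_function.

(** * The intertwining operator *)

Section det_operator.
Variables (R : realType) (k i : nat).
Local Notation V := 'M[R]_(k + k).
Local Notation U := [set x : V | x \in unitmx].
Local Notation G := (GL R (k + k)).
Local Notation src := (ind (triv_char R k)
  (mul_char (exp_char (det_char R k) i) (sgndet_char R k))).
Local Notation tgt := (ind (exp_char (det_char R k) i) (sgndet_char R k)).
Implicit Types (f g : src).

Let oU : open U. Proof. exact: open_unitmx. Qed.

Lemma Re_realM (c : R) (z : R[i]) : complex.Re (c%:C * z) = c * complex.Re z.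
Proof. by case: z => a b /=; rewrite mul0r subr0. Qed.

Lemma Im_realM (c : R) (z : R[i]) : complex.Im (c%:C * z) = c * complex.Im z.
Proof. by case: z => a b /=; rewrite mul0r addr0. Qed.

Lemma realM_complex (c a b : R) : (c * a) +i* (c * b) = c%:C * (a +i* b).
Proof. by apply/eqP; rewrite eq_complex /= !mul0r subr0 addr0 !eqxx. Qed.

Lemma src_smooth f : smooth f.
Proof. by have /asboolP[] := indfunP f. Qed.

Lemma src_induced f (g d B : 'M[R]_k) y : g \in unitmx -> d \in unitmx -> U y ->
  ext f (block_mx g B 0 d *m y) =
  (\det d ^+ i * Num.sg (\det d) * half_modulus g d)%:C * ext f y.
Proof.
move=> ug ud Uy; have /asboolP[_ H] := indfunP f.
have := H (MkGL ug) B (MkGL ud) (MkGL Uy).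
rewrite -[y]/(GLmx (MkGL Uy)) -[block_mx g B 0 d]/(GLmx (parab (MkGL ug) B (MkGL ud))).
rewrite -GL_mulE !extE => ->.
by rewrite mul1r /= exp_charE /= -rmorphXn -!rmorphM.
Qed.

Lemma det_op_subproof f : ind_pred (exp_char (det_char R k) i) (sgndet_char R k)
  (cact (detp R k ^+ i) f).
Proof.
apply/asboolP; split=> [|x11 x12 x22 y]; first exact/smooth_cact/src_smooth.
have /smooth_reim[sr si] := src_smooth f.
rewrite /cact !GL_mulE.
rewrite (act_det_induced sr) ?GLmx_unit//; last first.
- exact: (GLmx_unit y).
- by move=> g d B z ug ud Uz; rewrite /re src_induced// Re_realM.
rewrite (act_det_induced si) ?GLmx_unit//; last first.
- exact: (GLmx_unit y).
- by move=> g d B z ug ud Uz; rewrite /im src_induced// Im_realM.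
by rewrite realM_complex exp_charE /= -rmorphXn -!rmorphM.
Qed.

Definition det_op f : tgt := MkInd (det_op_subproof f).

Lemma det_op_is_linear : linear det_op.
Proof.
move=> a f g; apply/val_inj/funext => y /=.
have Uy : U (y : V) := GLmx_unit y.
have /smooth_reim[fr fi] := src_smooth f; have /smooth_reim[gr gi] := src_smooth g.
rewrite /cact.
have reE : re (a *: f + g : src) = fun z => complex.Re a * re f z +
    (- complex.Im a * im f z + re g z).
  apply/funext => z; rewrite /re /im (ext_lin a (f : G -> R[i]) g).
  by case: (a) (ext f z) (ext g z) => ? ? [? ?] [? ?] /=; rewrite mulNr addrA.
have imE : im (a *: f + g : src) = fun z => complex.Re a * im f z +
    (complex.Im a * re f z + im g z).
  apply/funext => z; rewrite /re /im (ext_lin a (f : G -> R[i]) g).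
  by case: (a) (ext f z) (ext g z) => ? ? [? ?] [? ?] /=; rewrite addrA.
have sl (c : R) h1 h2 : smooth_on U h1 -> smooth_on U h2 ->
    smooth_on U (fun z => c * h1 z + h2 z).
  move=> s1 s2; apply: smooth_onD => //; apply: smooth_onM => //.
  exact: smooth_on_cst.
rewrite reE imE.
rewrite !(act_linr (@lowFC R k))//; try exact: sl.
rewrite !fctE; apply/eqP; rewrite eq_complex; apply/andP; split; apply/eqP => /=.
  case: (a) => ? ? /=; ring.
case: (a) => ? ? /=; ring.
Qed.

HB.instance Definition _ :=
  GRing.isLinear.Build R[i] src tgt _ det_op det_op_is_linear.

(** The lower fields multiply on the left, so right multiplication preserves each of them and the
    substitution in [act_comp] is the identity. *)
Lemma det_op_rtrans (g : G) f : det_op (rtrans g f) = rtrans g (det_op f).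
Proof.
have /smooth_reim[fr fi] := src_smooth f.
apply/val_inj/funext => y; rewrite /= /rtrans_fun /cact GL_mulE.
pose L : {linear V -> V} := mulmxr g.
have UL z : U z -> U (L z) by move=> Uz; rewrite /= unitmx_mul Uz GLmx_unit.
have LZ (a b : 'I_k) (z : V) :
    L (lowN (delta_mx a b) *m z) = lowN (delta_mx a b) *m L z.
  by rewrite /= mulmxA.
have Uy : U (y : V) := GLmx_unit y.
have E h : smooth_on U h -> act (@lowF R k) (detp R k ^+ i) (h \o L) y =
    act (@lowF R k) (detp R k ^+ i) h (y *m g).
  move=> sh; rewrite (act_comp _ (@mulmxr_continuous _ _ g) UL LZ sh Uy).
  have -> : \matrix_(a, b) linp (delta_mx a b) =
      \matrix_(a, b) var R a b :> 'M[mpoly (k * k) R]_k.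
    apply/matrixP => a b; rewrite !mxE /linp (bigD1 a)//= (bigD1 b)//= mxE !eqxx scale1r.
    rewrite !big1 ?addr0// => [c ca|e eb].
      by rewrite big1// => e _; rewrite mxE (negbTE ca) scale0r.
    by rewrite mxE (negbTE eb) andbF scale0r.
  by rewrite rmorphXn /= subst_detp.
have extE' z : U z -> ext (rtrans_fun g f) z = ext f (L z).
  move=> Uz; rewrite -[z]/(GLmx (MkGL Uz)) -[L _]/(GLmx (MkGL Uz * g)%g).
  by rewrite !extE.
rewrite -!E//; congr (_ +i* _); apply: eq_act => // z Uz.
- by rewrite /re extE'.
- by rewrite /im extE'.
Qed.

Lemma test_ind_subproof : ind_pred (triv_char R k)
  (mul_char (exp_char (det_char R k) i) (sgndet_char R k))
  (fun y => (test_fun i (y : V))%:C).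
Proof.
have E z : U z -> ext (fun y : G => (test_fun i (y : V))%:C) z = (test_fun i z)%:C.
  by move=> Uz; rewrite -[z]/(GLmx (MkGL Uz)) extE.
apply/asboolP; split=> [|x11 x12 x22 y].
  apply/smooth_reim; split.
    by apply: eq_smooth_on (smooth_on_test_fun R k i) => // z Uz; rewrite /re E.
  by apply: eq_smooth_on (smooth_on_cst U 0) => // z Uz; rewrite /im E.
rewrite GL_mulE test_fun_induced ?GLmx_unit//; last exact: (GLmx_unit y).
by rewrite mul1r /= exp_charE /= -rmorphXn -!rmorphM.
Qed.

Lemma det_op_neq0 : exists f, det_op f <> 0.
Proof.
exists (MkInd test_ind_subproof) => /(congr1 (fun f : tgt => complex.Re (f 1%g))) /=.
have -> : act (@lowF R k) (detp R k ^+ i) (re (fun y : G => (test_fun i (y : V))%:C)) 1%:M =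
    act (@lowF R k) (detp R k ^+ i) (test_fun i) 1%:M.
  apply: eq_act; last exact: unitmx1.
  by move=> z Uz; rewrite /re -[z]/(GLmx (MkGL Uz)) extE.
exact/eqP/act_test_fun_neq0.
Qed.

End det_operator.

Theorem proposition1p4 (R : realType) (k : nat) (hk : (0 < k)%N)
    (i : nat) (hi : (0 < i)%N) :
  exists T : {linear
      ind (triv_char R k)
          (mul_char (exp_char (det_char R k) i) (sgndet_char R k)) ->
      ind (exp_char (det_char R k) i) (sgndet_char R k)},
    intertwining T /\ exists f, T f <> 0.
Proof.
exists (@det_op R k i : {linear _ -> _}); split; last exact: det_op_neq0.
by split; [exact: cact_continuous|exact: det_op_rtrans].
Qed.
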